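(* Let $q$ be a power of an odd prime and $G=\mathrm{GL}_2(\mathbb{F}_q)$. Let $\Lambda,\Phi\in\widehat{T_{-1}}$ be two indecomposable characters and let $\alpha,\beta,\gamma,\delta\in\widehat{\mathbb{F}_q^\times}$ be such that $\alpha\neq\beta$ and $\gamma\neq\delta$. Then $\chi_{(\alpha,\beta)}^{q+1}\otimes\chi_\Lambda^{-1}=\chi_{(\gamma,\delta)}^{q+1}\otimes\chi_\Phi^{-1}$ if and only if $\alpha\beta\bar\Lambda=\gamma\delta\bar\Phi$. In particular, for $q\neq3$, the tensor product $\chi_{(\alpha,\beta)}^{q+1}\otimes\chi_\Lambda^{-1}$ does not have the unique decomposition property.
   Context: All representations are complex and finite-dimensional, equality of representations means isomorphism, and $\mathrm{Irr}(G)$ is the set of irreducible representations of $G$ (up to isomorphism); $\widehat{A}$ is the group of characters $A\to\mathbb{C}^\times$ of a finite abelian group $A$, with pointwise products and powers. $B\subset G$ is the subgroup of upper-triangular matrices. For $\alpha,\beta\in\widehat{\mathbb{F}_q^\times}$, $(\alpha,\beta)$ is the character of $B$ given by $\begin{pmatrix}x&z\\0&y\end{pmatrix}\mapsto\alpha(x)\beta(y)$, and for $\alpha\neq\beta$, $\chi_{(\alpha,\beta)}^{q+1}=\mathrm{Ind}_B^G(\alpha,\beta)$, irreducible of dimension $q+1$. $T_{-1}\subset G$ is the anisotropic torus, i.e. the image of $\mathbb{F}_{q^2}^\times$ acting by multiplication on $\mathbb{F}_{q^2}\cong\mathbb{F}_q^2$. A character $\Lambda\in\widehat{T_{-1}}$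 is decomposable if $\Lambda=\alpha\circ\det$ (restricted to $T_{-1}$) for some $\alpha\in\widehat{\mathbb{F}_q^\times}$, and indecomposable otherwise; $\bar\Lambda\in\widehat{\mathbb{F}_q^\times}$ is $\bar\Lambda(x)=\Lambda(xI)$. For indecomposable $\Lambda$, $\chi_\Lambda^{-1}$ is the irreducible cuspidal representation of $G$ of dimension $q-1$ whose character is $(q-1)\bar\Lambda(x)$ at $xI$, $-\bar\Lambda(x)$ at $\begin{pmatrix}x&1\\0&x\end{pmatrix}$, $0$ at elements with two distinct eigenvalues in $\mathbb{F}_q$, and $-(\Lambda(t)+\Lambda(t)^q)$ at non-scalar $t\in T_{-1}$. For $V_1,V_2\in\mathrm{Irr}(G)$, $V_1\otimes V_2$ has the unique decomposition property if, whenever $W_1,W_2\in\mathrm{Irr}(G)$ satisfy $V_1\otimes V_2=W_1\otimes W_2$, there exist one-dimensional representations $\chi_1,\chi_2$ of $G$ and a permutation $\sigma$ of $\{1,2\}$ such that $V_i=\chi_i\otimes W_{\sigma(i)}$ for $i=1,2$. *)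

(* Defs.v *)
Set Warnings "-notation-overridden,-ambiguous-paths".
From HB Require Import structures.
From mathcomp Require Import all_boot all_algebra all_fingroup all_field.
From mathcomp Require Import mxrepresentation character.
From mathcomp Require Export complex.
From mathcomp Require Import reals.

Set Implicit Arguments.
Unset Strict Implicit.
Unset Printing Implicit Defensive.

Import GRing.Theory.
Local Open Scope ring_scope.

(* A one-dimensional character of A with values in C^*; nonvanishing on A is
   forced by the two axioms when A is a group. As for mx_representation,
   values outside A are unconstrained, so characters must only be compared
   on A. *)
Record lchar (C : fieldType) (gT : finGroupType) (A : {set gT}) := LChar {
  lchar_fun :> gT -> C;
  lchar1 : lchar_fun 1%g = 1;
  lcharM : {in A &, {morph lchar_fun : x y / (x * y)%g >-> x * y}}
}.

Definition eq_lchar (C : fieldType) (gT : finGroupType) (A : {set gT})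
  (chi psi : lchar C A) : Prop := {in A, chi =1 psi}.

Section Induction.

Variables (C : fieldType) (gT : finGroupType) (G H : {group gT}).
Variables (sHG : H \subset G) (chi : lchar C H).

Definition lchar_ext (x : gT) : C := if x \in H then chi x else 0.

Definition ind_rep (i : 'I_#|rcosets H G|) : gT := repr (enum_val i).

(* The right translation f |-> (x |-> f (x * g)) on the functions f : G -> C
   such that f (h * x) = chi h * f x for h in H, as a matrix acting on the
   columns of the values of f at the representatives of the right cosets of H. *)
Definition ind_mx (g : gT) : 'M[C]_#|rcosets H G| :=
  \matrix_(i, j) lchar_ext (ind_rep i * g * (ind_rep j)^-1)%g.

Lemma ind_rep_coset i : enum_val i = (H :* ind_rep i)%g.
Proof.
rewrite /ind_rep; have /rcosetsP[x Gx ->] := enum_valP i.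
by rewrite rcoset_repr.
Qed.

Lemma ind_repG i : ind_rep i \in G.
Proof.
rewrite /ind_rep; have /rcosetsP[x Gx ->] := enum_valP i.
have /rcosetP[h Hh ->] := mem_repr_rcoset H x.
by rewrite groupM // (subsetP sHG).
Qed.

Lemma ind_mx_repr : mx_repr G ind_mx.
Proof.
split=> [|g h Gg Gh].
  apply/matrixP=> i j; rewrite !mxE mulg1 /lchar_ext -mem_rcoset.
  have -> : (ind_rep i \in H :* ind_rep j)%g = (i == j).
    apply/idP/eqP => [/rcoset_eqP eqij|->]; last exact: rcoset_refl.
    by apply: enum_val_inj; rewrite !ind_rep_coset eqij.
  by case: eqP => [->|]; rewrite ?mulgV ?lchar1.
apply/matrixP=> i k; rewrite !mxE.
have GHx : (H :* (ind_rep i * g))%g \in rcosets H G.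
  by apply/rcosetsP; exists (ind_rep i * g)%g; rewrite // groupM ?ind_repG.
pose j := enum_rank_in GHx (H :* (ind_rep i * g))%g.
have Hj : (H :* ind_rep j = H :* (ind_rep i * g))%g.
  by rewrite -ind_rep_coset enum_rankK_in.
have Hij : (ind_rep i * g * (ind_rep j)^-1)%g \in H.
  by rewrite -mem_rcoset Hj rcoset_refl.
rewrite (bigD1 j) //= big1 ?addr0 => [|l nlj]; last first.
  rewrite !mxE {1}/lchar_ext -mem_rcoset ifN ?mul0r //.
  apply: contra nlj => /rcoset_eqP eql; apply/eqP/enum_val_inj.
  by rewrite !ind_rep_coset Hj eql.
rewrite !mxE {2}/lchar_ext Hij /lchar_ext.
have -> : (ind_rep i * (g * h) * (ind_rep k)^-1 =
  (ind_rep i * g * (ind_rep j)^-1) * (ind_rep j * h * (ind_rep k)^-1))%g.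
  by rewrite !mulgA mulgKV.
rewrite groupMl //; case: ifP => Hjk; last by rewrite mulr0.
by rewrite lcharM.
Qed.

Definition ind_repr : representation C G :=
  Representation (MxRepresentation ind_mx_repr).

End Induction.

(* Only meaningful for invertible x: the other elements are sent to 1. *)
Definition to_unit (R : finUnitRingType) (x : R) : {unit R} := insubd (1%g : {unit R}) x.

Definition toGL2 (F : finFieldType) (M : 'M[F]_2) : {'GL_2[F]} := to_unit M.

Section GL2.

Variables (C : fieldType) (F : finFieldType).

Definition Fchar := lchar C [set: {unit F}].

Definition GL2_rep := representation C 'GL_2[F].

Definition GL2_det (g : {'GL_2[F]}) : {unit F} := to_unit (\det (GLval g)).

Definition GL2_scalar (x : {unit F}) : {'GL_2[F]} := toGL2 (val x)%:M.

(* The matrix (x 1; 0 x). *)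
Definition GL2_jordan (x : {unit F}) : {'GL_2[F]} :=
  toGL2 ((val x)%:M + delta_mx ord0 ord_max).

(* is_trig_mx means lower triangular. *)
Definition borel : {set {'GL_2[F]}} := [set g | is_trig_mx (GLval g)^T].

Lemma borelE g : (g \in borel) = (GLval g ord_max ord0 == 0).
Proof.
rewrite inE; apply/is_trig_mxP/eqP => [/(_ ord0 ord_max isT)|g10 i j].
  by rewrite mxE.
rewrite mxE; case: i j => [[|[|i]] ?] [[|[|j]] ?] //= _.
by rewrite -[RHS]g10; congr (GLval g _ _); apply: val_inj.
Qed.

Lemma borel_mulE (g h : {'GL_2[F]}) i : g \in borel -> h \in borel ->
  GLval (g * h)%g i i = GLval g i i * GLval h i i.
Proof.
rewrite !borelE => /eqP g10 /eqP h10; rewrite GL_MxE mxE !big_ord_recl big_ord0.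
have -> : lift ord0 ord0 = ord_max :> 'I_2 by apply: val_inj.
case: i => [[|[|i]] lti] //=.
  have -> : Ordinal lti = ord0 by apply: val_inj.
  by rewrite h10 mulr0 !addr0.
have -> : Ordinal lti = ord_max by apply: val_inj.
by rewrite g10 mul0r add0r addr0.
Qed.

Lemma borel_group_set : group_set borel.
Proof.
apply/group_setP; split=> [|g h]; first by rewrite borelE GL_1E mxE.
rewrite !borelE => /eqP g10 /eqP h10.
rewrite GL_MxE mxE !big_ord_recl big_ord0.
have -> : lift ord0 ord0 = ord_max :> 'I_2 by apply: val_inj.
by rewrite h10 g10 mulr0 mul0r !addr0.
Qed.

Canonical borel_group := Group borel_group_set.

Lemma borel_diag_unit g i : g \in borel -> GLval g i i \is a GRing.unit.
Proof.
move=> Bg; rewrite unitfE; apply/eqP=> gii0.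
have: GLval (g * g^-1)%g i i = 0.
  by rewrite borel_mulE ?gii0 ?mul0r // groupV.
by rewrite mulgV GL_1E mxE eqxx => /eqP; rewrite oner_eq0.
Qed.

Definition borel_char_fun (alpha beta : Fchar) (g : {'GL_2[F]}) : C :=
  alpha (to_unit (GLval g ord0 ord0)) * beta (to_unit (GLval g ord_max ord_max)).

Lemma to_unitM (x y : F) : x \is a GRing.unit -> y \is a GRing.unit ->
  to_unit (x * y) = (to_unit x * to_unit y)%g.
Proof.
move=> Ux Uy; apply: val_inj; rewrite FinRing.val_unitM !insubdK //.
by rewrite unfold_in unitrM Ux.
Qed.

Lemma borel_char1 alpha beta : borel_char_fun alpha beta 1%g = 1.
Proof.
have to_unit1 : to_unit (1 : F) = 1%g by apply: val_inj; rewrite insubdK ?unitr1.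
by rewrite /borel_char_fun GL_1E !mxE !eqxx to_unit1 !lchar1 mulr1.
Qed.

Lemma borel_charM alpha beta :
  {in borel &, {morph borel_char_fun alpha beta : x y / (x * y)%g >-> x * y}}.
Proof.
move=> g h Bg Bh; rewrite /borel_char_fun !borel_mulE //.
by rewrite !to_unitM ?borel_diag_unit // !lcharM ?inE // mulrACA.
Qed.

Definition borel_char (alpha beta : Fchar) : lchar C borel :=
  LChar (borel_char1 alpha beta) (@borel_charM alpha beta).

Definition principal_series (alpha beta : Fchar) : GL2_rep :=
  ind_repr (subsetT borel_group) (borel_char alpha beta).

Definition irrep (V : GL2_rep) : Prop := mx_irreducible V.

Definition iso (n m : nat) (V : mx_representation C 'GL_2[F] n)
  (W : mx_representation C 'GL_2[F] m) : Prop := mx_rsim V W.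

(* The last conjunct spells out the two permutations of {1, 2}. *)
Definition unique_decomposition (V1 V2 : GL2_rep) : Prop :=
  forall W1 W2 : GL2_rep, irrep W1 -> irrep W2 ->
  iso (prod_repr V1 V2) (prod_repr W1 W2) ->
  exists chi1 chi2 : mx_representation C 'GL_2[F] 1,
    (iso V1 (prod_repr chi1 W1) /\ iso V2 (prod_repr chi2 W2)) \/
    (iso V1 (prod_repr chi1 W2) /\ iso V2 (prod_repr chi2 W1)).

Section AnisotropicTorus.

Variables (L : fieldExtType F) (e : 2.-tuple L).

(* Matrix of the multiplication by z, acting on columns of coordinates in the
   basis e of L over F. *)
Definition mul_mx (z : L) : 'M[F]_2 := \matrix_(i, j) coord e i (z * tnth e j).

(* finvect_type L is L with its structure of finite type. *)
Definition torus : {set {'GL_2[F]}} :=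
  [set toGL2 (mul_mx z) | z : finvect_type L & z != 0].

Definition torus_char := lchar C torus.

Definition decomposable (Lam : torus_char) : Prop :=
  exists alpha : Fchar, {in torus, forall t, Lam t = alpha (GL2_det t)}.

Definition bar (Lam : torus_char) (x : {unit F}) : C := Lam (GL2_scalar x).

Record is_cuspidal_rep (Lam : torus_char) (V : GL2_rep) : Prop := IsCuspidalRep {
  cusp_irr : irrep V;
  cusp_dim : rdegree V = #|F|.-1;
  cusp_scalar : forall x : {unit F},
    \tr (V (GL2_scalar x)) = #|F|.-1%:R * bar Lam x;
  cusp_jordan : forall x : {unit F}, \tr (V (GL2_jordan x)) = - bar Lam x;
  cusp_split : forall (g : {'GL_2[F]}) (a b : F), a != b ->
    eigenvalue (GLval g) a -> eigenvalue (GLval g) b -> \tr (V g) = 0;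
  cusp_torus : forall t : {'GL_2[F]}, t \in torus ->
    ~~ is_scalar_mx (GLval t) -> \tr (V t) = - (Lam t + Lam t ^+ #|F|)
}.

End AnisotropicTorus.

End GL2.

(* Main.v *)
Require Import Defs.
Set Warnings "-notation-overridden,-ambiguous-paths".
From mathcomp Require Import all_boot all_algebra all_fingroup all_solvable all_field.
From mathcomp Require Import mxrepresentation character complex reals.

From mathcomp Require Import ring.

Set Implicit Arguments.
Unset Strict Implicit.
Unset Printing Implicit Defensive.

Import GRing.Theory Num.Theory.
Local Open Scope ring_scope.

(** Write q for the cardinal of F, G for GL_2(F), B for the Borel subgroup of
    upper triangular matrices and U for its unipotent radical.

    _The equivalence._  An element of G without eigenvalue in F has no
    conjugate in B, so the trace of a representation induced from B vanishes
    there; at an element with two distinct eigenvalues in F the trace of a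
    cuspidal representation vanishes.  Hence the character of the product of a
    principal series and a cuspidal representation lives on the conjugates of
    the scalars x and of the Jordan blocks (x 1; 0 x).  There it is determined
    by the central character: its values are (q+1)(q-1) and -1 times
    alpha beta omega (x), with omega the central character of the cuspidal
    factor ([ps_prod_rsim], [ps_prod_central]).  What turns this equality of
    traces into an isomorphism is the theorem that in characteristic 0 a
    representation is determined by its character ([mx_rsim_of_mxtrace]); it
    is proved by splitting off isomorphic simple submodules, which the central
    idempotents of the group ring detect by traces.

    _Failure of unique decomposition._  By the equivalence it is enough to find
    a cuspidal representation W that is no twist of the given V, and characters
    gamma <> delta for which the central characters match.  A one-dimensional
    representation takes square values on the scalars: x I is the product of
    diag(x, 1) and diag(1, x), which are conjugate ([linear_mxtrace_scalar]).
    So W cannot be a twist of V when its central character is kappa omega with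
    kappa a generator of the dual of F^*, hence not a square; and for q > 3
    there is room to choose gamma <> delta ([factor_Fchar]).

    _Existence of W._  No cuspidal representation is constructed explicitly.
    Let T be the product of V with the principal series of (1, kappa).  By the
    Bruhat decomposition, G is the disjoint union of B and B w U, so the
    submodule generated by the U-invariants of a representation has dimension
    at most q times the dimension of these invariants ([rank_unipotent_span]).  For T this bound is q(q-1), less
    than dim T = (q+1)(q-1), so T has a simple constituent W without U-invariant
    vectors ([cuspidal_constituent]).  It remains to see that every irreducible
    W without U-invariants has dimension q-1 and the expected character on B.
    On U the trace is constant away from 1, and the absence of invariants gives
    tr P = q dim W / (q-1) for the operator P which projects, up to the factor
    q, onto the psi-eigenspace of U, for psi a nontrivial character of U.  The
    operators P W(g) P commute with each other ([bessel_comm]): this is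
    Gelfand's trick for the anti-automorphism of G that swaps the two diagonal
    entries, i.e. the uniqueness of Whittaker models.  As W is absolutely
    irreducible, P X P and P Y P then commute for all matrices X and Y, which
    forces (tr P)^2 = q^2 ([sandwich_mxtrace]), whence dim W = q-1
    ([cuspidal_degree]). *)


(** * Representations with equal traces are isomorphic *)

Section TracesDetermineRepresentations.

Variables (C : numClosedFieldType) (gT : finGroupType) (G : {group gT}).

(** In a rank factorization A = L R of an idempotent, R L is the identity of
    size rank A, and it has the same trace as A. *)
Lemma mxtrace_idempotent (K : fieldType) n (A : 'M[K]_n) :
  A *m A = A -> \tr A = (\rank A)%:R.
Proof.
move=> idA; rewrite -[A in LHS]mulmx_base mxtrace_mulC.
suffices ->: row_base A *m col_base A = 1%:M by rewrite mxtrace1.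
apply: (row_free_inj (row_base_free A)); rewrite mul1mx.
apply: (row_full_inj (col_base_full A)).
move: (mulmx_base A); move: (col_base A) (row_base A) => B D defA.
by rewrite !mulmxA defA -mulmxA defA idA.
Qed.

Lemma pchar'_group : pgroup [pchar C]^' G.
Proof. by rewrite /pgroup pcharf'_nat pnatr_eq0 -lt0n cardG_gt0. Qed.

Lemma rank_direct_sum (K : fieldType) n (M N : 'M[K]_n) :
  (M + N :=: 1%:M)%MS -> mxdirect (M + N) -> (\rank M + \rank N)%N = n.
Proof. by move=> MN dMN; rewrite -(mxdirectP dMN) /= MN mxrank1. Qed.

Lemma val_submod_sum n (rV : mx_representation C G n) (M : 'M_n)
    (modM : mxmodule rV M) (a : gT -> C) :
  val_submod (\sum_(x in G) a x *: submod_repr modM x) =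
  val_submod 1%:M *m (\sum_(x in G) a x *: rV x).
Proof.
rewrite linear_sum mulmx_sumr; apply: eq_bigr => x Gx.
by rewrite linearZ -scalemxAr -val_submodJ // mul1mx.
Qed.

(** The simple module M determines a central idempotent e of the group ring that
    acts as the identity on M and as 0 on the simple modules not isomorphic to
    M.  The traces of e on V and W agree, and in characteristic 0 a nonzero
    idempotent has nonzero trace; so e does not kill W, and any simple summand
    of W that it does not kill is isomorphic to M. *)
Lemma simple_with_same_trace n m (rV : mx_representation C G n)
    (rW : mx_representation C G m) (M : 'M_n) (modM : mxmodule rV M) :
  {in G, forall x, \tr (rV x) = \tr (rW x)} -> mxsimple rV M ->
  exists (N : 'M_m) (modN : mxmodule rW N),
    N != 0 /\ mx_rsim (submod_repr modM) (submod_repr modN).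
Proof.
move=> eqVW simM; have C'G := pchar'_group.
pose sG : irrType C G := DecSocleType (regular_repr C G).
have irrM : mx_irreducible (submod_repr modM) by apply/submod_mx_irr.
pose i := irr_comp sG (submod_repr modM).
pose e := Wedderburn_id i.
have [_ Re eA _] := Wedderburn_is_id_pchar C'G i.
have Ge : (e \in group_ring C G)%MS.
  by rewrite -(Wedderburn_sum_pchar sG C'G) (sumsmx_sup i) // Wedderburn_id_mem.
have [a def_e] := envelop_mxP Ge.
have opE k (rG : mx_representation C G k) :
    gring_op rG e = \sum_(x in G) a x *: rG x.
  rewrite def_e linear_sum; apply: eq_bigr => x Gx.
  by rewrite linearZ /= gring_opG.
have idV k (rG : mx_representation C G k) :
    gring_op rG e *m gring_op rG e = gring_op rG e.
  by rewrite -gring_opM // -/e eA.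
have trVW : \tr (gring_op rV e) = \tr (gring_op rW e).
  rewrite !opE !raddf_sum; apply: eq_bigr => x Gx /=.
  by rewrite !mxtraceZ eqVW.
(* All other central idempotents kill M, and their sum with e is 1. *)
have nzM : gring_op (submod_repr modM) e != 0.
  have [_ nz1 _] := irrM; apply: contraNneq nz1 => opM0.
  rewrite -(gring_op1 (submod_repr modM)) -(Wedderburn_sum_id_pchar sG C'G).
  rewrite linear_sum big1 // => j _; have [-> //|ij] := eqVneq j i.
  exact: (irr_comp'_op0_pchar C'G irrM ij (Wedderburn_id_mem j)).
have nzV : gring_op rV e != 0.
  apply: contraNneq nzM => opV0; rewrite -val_submod_eq0 opE val_submod_sum.
  by rewrite -opE opV0 mulmx0.
have nzW : gring_op rW e != 0.
  apply: contraNneq nzV => opW0; rewrite -mxrank_eq0 -(pnatr_eq0 C).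
  by rewrite -mxtrace_idempotent // trVW opW0 mxtrace0.
have [N simN nzN] : exists2 N, mxsimple rW N & N *m gring_op rW e != 0.
  have [I W_ /= simW sumW _] := dec_mx_reducible_semisimple (mxmodule1 rW)
    (mx_Maschke_pchar rW C'G).
  have [j /negPf nz_j | W0] := pickP (fun j => W_ j *m gring_op rW e != 0).
    by exists (W_ j); rewrite ?nz_j.
  case/eqP: nzW; apply/eqP; rewrite -submx0 -[X in (X <= _)%MS]mul1mx.
  rewrite -(eqmxMr _ sumW) sumsmxMr; apply/sumsmx_subP=> j _.
  by have /negbFE/eqP-> := W0 j; rewrite sub0mx.
have modN := mxsimple_module simN; have [_ nzN0 _] := simN; exists N, modN.
split=> //.
have irrN : mx_irreducible (submod_repr modN) by apply/submod_mx_irr.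
have opN : gring_op (submod_repr modN) e != 0.
  apply: contraNneq nzN => opN0; rewrite -submx0.
  rewrite -(eqmxMr _ (val_submod1 N)) opE -val_submod_sum -opE.
  by rewrite opN0 submx0 val_submod_eq0.
have eq_i : i = irr_comp sG (submod_repr modN).
  apply: contraNeq opN => ne_i; apply/eqP.
  exact: (irr_comp'_op0_pchar C'G irrN ne_i (Wedderburn_id_mem i)).
apply: mx_rsim_trans (rsim_irr_comp_pchar sG C'G irrM) _.
rewrite -/i eq_i; exact/mx_rsim_sym/(rsim_irr_comp_pchar sG C'G irrN).
Qed.

(** Induction on the dimension: isomorphic simple submodules of V and W are
    removed, and their Maschke complements again have equal traces. *)
Theorem mx_rsim_of_mxtrace n m (rV : mx_representation C G n)
    (rW : mx_representation C G m) :
  {in G, forall x, \tr (rV x) = \tr (rW x)} -> mx_rsim rV rW.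
Proof.
have C'G := pchar'_group.
have [r] := ubnP n; elim: r => // r IHr in n m rV rW *; rewrite ltnS => le_n eqVW.
have eq_nm : n = m.
  by apply/eqP; rewrite -(eqr_nat C) -!mxtrace1 -!(repr_mx1 rV, repr_mx1 rW) eqVW.
case: n => [|n] in rV le_n eqVW eq_nm *.
  case: m / eq_nm rW eqVW => rW _; exists 1%:M => [//||x _].
    by rewrite /row_free mxrank1.
  by rewrite mulmx1 mul1mx [LHS]flatmx0 [RHS]flatmx0.
have [M simM _] := dec_mxsimple_exists (mxmodule1 rV)
  (oner_neq0 ('M[C]_n.+1 : nzRingType)).
have modM := mxsimple_module simM.
have [N [modN [nzN simMN]]] := simple_with_same_trace modM eqVW simM.
have [M' modM' sumM dxM] := mx_Maschke_pchar rV C'G modM (submx1 M).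
have [N' modN' sumN dxN] := mx_Maschke_pchar rW C'G modN (submx1 N).
have simM'N' : mx_rsim (submod_repr modM') (submod_repr modN').
  apply: IHr => [|x Gx].
    have nzM : M != 0 by case: simM.
    have := rank_direct_sum sumM dxM; rewrite -mxrank_eq0 in nzM.
    move=> defn; apply: leq_trans (_ : \rank M' < \rank M + \rank M')%N _.
      by rewrite -[ltnLHS]add0n ltn_add2r lt0n.
    by rewrite defn.
  apply: (addrI (\tr (submod_repr modM x))).
  rewrite (mxtrace_dadd_mod modM modM' (mxmodule1 rV)) //.
  rewrite (mxtrace_rsim simMN) //.
  rewrite (mxtrace_dadd_mod modN modN' (mxmodule1 rW)) //.
  by rewrite !mxtrace_submod1 // eqVW.
pose rN := Representation (submod_repr modN).
pose rN' := Representation (submod_repr modN').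
have simV : mx_rsim rV (dadd_grepr rN rN').
  apply: mx_rsim_trans (mx_rsim_sym (rsim_submod1 (mxmodule1 rV) _)) _ => //.
  exact: (mx_rsim_dadd (rU := rN) (rV := rN') (mxmodule1 rV) sumM dxM).
apply: mx_rsim_trans simV (mx_rsim_sym _).
apply: mx_rsim_trans (mx_rsim_sym (rsim_submod1 (mxmodule1 rW) _)) _ => //.
apply: (mx_rsim_dadd (rU := rN) (rV := rN') (mxmodule1 rW) sumN dxN).
  exact: mx_rsim_refl.
exact: mx_rsim_refl.
Qed.

End TracesDetermineRepresentations.

(** * Coordinates on GL_2(F) and the Bruhat decomposition *)

Section Coordinates.

Variable F : finFieldType.
Implicit Types (a b c d s t : F) (g h : {'GL_2[F]}).

Lemma GLval_inj : injective (@GLval 2 F).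
Proof. exact: val_inj. Qed.

Definition mx22 a b c d : 'M[F]_2 :=
  \matrix_(i, j) if i == ord0 then if j == ord0 then a else b
                 else if j == ord0 then c else d.

Definition gl2 a b c d : {'GL_2[F]} := toGL2 (mx22 a b c d).

Arguments gl2 (a b c d)%_ring_scope.

Lemma ord2P (i : 'I_2) : i = ord0 \/ i = ord_max.
Proof. by case: i => [[|[|i]] lti] //; [left | right]; apply: val_inj. Qed.

Lemma big_ord2 (R : nmodType) (f : 'I_2 -> R) : \sum_i f i = f ord0 + f ord_max.
Proof.
rewrite !big_ord_recl big_ord0 addr0; congr (_ + f _).
exact: val_inj.
Qed.

Lemma eq_mx22 (A B : 'M[F]_2) :
  A ord0 ord0 = B ord0 ord0 -> A ord0 ord_max = B ord0 ord_max ->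
  A ord_max ord0 = B ord_max ord0 -> A ord_max ord_max = B ord_max ord_max ->
  A = B.
Proof.
move=> e00 e01 e10 e11; apply/matrixP=> i j.
by case: (ord2P i) (ord2P j) => -> [] ->.
Qed.

Lemma mx22_eta (A : 'M[F]_2) :
  A = mx22 (A ord0 ord0) (A ord0 ord_max) (A ord_max ord0) (A ord_max ord_max).
Proof. by apply: eq_mx22; rewrite !mxE. Qed.

Lemma mx22M a b c d a' b' c' d' : mx22 a b c d *m mx22 a' b' c' d' =
  mx22 (a * a' + b * c') (a * b' + b * d') (c * a' + d * c') (c * b' + d * d').
Proof. by apply: eq_mx22; rewrite !mxE big_ord2 !mxE. Qed.

Lemma det_mx22 a b c d : \det (mx22 a b c d) = a * d - b * c.
Proof.
rewrite (expand_det_row _ ord0) big_ord2 /cofactor !det_mx11 !mxE /=.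
by rewrite expr0 expr1 mul1r mulN1r mulrN.
Qed.

Lemma val_gl2 a b c d : a * d - b * c != 0 -> GLval (gl2 a b c d) = mx22 a b c d.
Proof. by move=> nz; apply: insubdK; rewrite unfold_in /= unitmxE det_mx22 unitfE. Qed.

Lemma gl2P g : exists a b c d, a * d - b * c != 0 /\ g = gl2 a b c d.
Proof.
have := GL_unitmx g; rewrite unitmxE unitfE.
rewrite [\val g]mx22_eta det_mx22.
set a := _ ord0 ord0; set b := _ ord0 ord_max.
set c := _ ord_max ord0; set d := _ ord_max ord_max => nz.
exists a, b, c, d; split=> //; apply: GLval_inj.
by rewrite [LHS]mx22_eta (val_gl2 nz).
Qed.

Lemma gl2M a b c d a' b' c' d' :
  a * d - b * c != 0 -> a' * d' - b' * c' != 0 ->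
  (gl2 a b c d * gl2 a' b' c' d')%g =
  gl2 (a * a' + b * c') (a * b' + b * d') (c * a' + d * c') (c * b' + d * d').
Proof.
move=> nz nz'; apply: GLval_inj; rewrite GL_MxE !val_gl2 ?mx22M //.
have <- : (a * d - b * c) * (a' * d' - b' * c') =
   (a * a' + b * c') * (c * b' + d * d') - (a * b' + b * d') * (c * a' + d * c').
  by ring.
by rewrite mulf_neq0.
Qed.

Lemma gl2_1 : gl2 1 0 0 1 = 1%g.
Proof.
apply: GLval_inj; rewrite GL_1E val_gl2; last by rewrite !mulr1 mulr0 subr0 oner_neq0.
by apply: eq_mx22; rewrite !mxE.
Qed.

Lemma scalarE (x : {unit F}) : GL2_scalar x = gl2 (val x) 0 0 (val x).
Proof. by congr toGL2; apply: eq_mx22; rewrite !mxE ?mulr1n ?mulr0n. Qed.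

Lemma jordanE (x : {unit F}) : GL2_jordan x = gl2 (val x) 1 0 (val x).
Proof.
congr toGL2; apply: eq_mx22; rewrite !mxE /= ?mulr1n ?mulr0n ?addr0 ?add0r //.
Qed.

Lemma gl2_borel a b c d : a * d - b * c != 0 -> (gl2 a b c d \in borel F) = (c == 0).
Proof. by move=> nz; rewrite borelE val_gl2 // mxE. Qed.

Lemma val_unit_neq0 (x : {unit F}) : val x != 0.
Proof. by rewrite -unitfE; case: x. Qed.

Lemma val_to_unit a : a != 0 -> val (to_unit a) = a.
Proof. by move=> nza; apply: insubdK; rewrite unfold_in unitfE. Qed.

Lemma to_unitK (x : {unit F}) : to_unit (val x) = x.
Proof. by apply: val_inj; rewrite val_to_unit ?val_unit_neq0. Qed.

Definition uni s : {'GL_2[F]} := gl2 1 s 0 1.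
Definition weyl : {'GL_2[F]} := gl2 0 1 1 0.

Lemma uni_det s : 1 * 1 - s * 0 != 0 :> F.
Proof. by rewrite mulr0 subr0 mulr1 oner_neq0. Qed.

Lemma weyl_det : 0 * 0 - 1 * 1 != 0 :> F.
Proof. by rewrite mulr0 sub0r oppr_eq0 mulr1 oner_neq0. Qed.

Lemma diag_det a d : a != 0 -> d != 0 -> a * d - 0 * 0 != 0.
Proof. by move=> nza nzd; rewrite mulr0 subr0 mulf_neq0. Qed.

Lemma upper_det a b d : a != 0 -> d != 0 -> a * d - b * 0 != 0.
Proof. by move=> nza nzd; rewrite mulr0 subr0 mulf_neq0. Qed.

Lemma upperM a b d a' b' d' : a != 0 -> d != 0 -> a' != 0 -> d' != 0 ->
  (gl2 a b 0 d * gl2 a' b' 0 d')%g = gl2 (a * a') (a * b' + b * d') 0 (d * d').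
Proof. by move=> *; rewrite gl2M ?upper_det //; congr gl2; ring. Qed.

Lemma uniD s t : uni (s + t) = (uni s * uni t)%g.
Proof. by rewrite /uni gl2M ?uni_det //; congr gl2; ring. Qed.

Lemma uni0 : uni 0 = 1%g. Proof. exact: gl2_1. Qed.

Lemma uniN s : uni (- s) = (uni s)^-1%g.
Proof.
by apply: (mulgI (uni s)); rewrite mulgV -uniD subrr uni0.
Qed.

Lemma borelP g : g \in borel F ->
  exists a b d, [/\ a != 0, d != 0 & g = gl2 a b 0 d].
Proof.
have [a [b [c [d [nz ->]]]]] := gl2P g; rewrite gl2_borel // => /eqP c0.
exists a, b, d; rewrite -c0; split=> //.
  by apply: contraNneq nz => ->; rewrite c0 mul0r mulr0 subr0.
by apply: contraNneq nz => ->; rewrite c0 !mulr0 subr0.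
Qed.

(** Left multiplication by B and the right action of U normalize the bottom row
    (c, d), c <> 0, to (1, 0); the translation is by d / c. *)
Lemma bruhat g : g \notin borel F ->
  exists2 b, b \in borel F & exists s, g = (b * weyl * uni s)%g.
Proof.
have [a [b [c [d [nz ->]]]]] := gl2P g; rewrite gl2_borel // => nzc.
have nzb : b - a * d / c != 0.
  apply: contraNneq nz => e.
  have -> : a * d - b * c = - ((b - a * d / c) * c) by field.
  by rewrite e mul0r oppr0.
exists (gl2 (b - a * d / c) a 0 c); first by rewrite gl2_borel ?upper_det.
exists (d / c); rewrite [(gl2 (b - a * d / c) a 0 c * _)%g]gl2M ?upper_det ?weyl_det //.
rewrite gl2M ?uni_det //.
  by congr gl2; field.
rewrite (_ : _ - _ = - ((b - a * d / c) * c)); last by ring.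
by rewrite oppr_eq0 mulf_neq0.
Qed.

Lemma weyl_uni_notin_borel s : (weyl * uni s)%g \notin borel F.
Proof.
rewrite /weyl /uni gl2M ?weyl_det ?uni_det // gl2_borel.
  by rewrite mulr1 mulr0 addr0 oner_eq0.
rewrite (_ : _ - _ = -1) ?oppr_eq0 ?oner_eq0 //; ring.
Qed.

Lemma weylV : (weyl)^-1%g = weyl.
Proof.
apply: (mulgI (weyl)); rewrite mulgV /weyl gl2M ?weyl_det // -gl2_1.
by congr gl2; ring.
Qed.

Lemma borelV g : (g^-1%g \in borel F) = (g \in borel F).
Proof.
have gl_groupV (H : {group {'GL_2[F]}}) x : (x^-1%g \in H) = (x \in H).
  exact: groupV.
exact: (gl_groupV (borel_group F) g).
Qed.

Lemma borelMl (b g : {'GL_2[F]}) : b \in borel F ->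
  ((b * g)%g \in borel F) = (g \in borel F).
Proof.
have gl_groupMl (H : {group {'GL_2[F]}}) x y : y \in H -> ((y * x)%g \in H) = (x \in H).
  exact: groupMl.
exact: (gl_groupMl (borel_group F) g b).
Qed.

Lemma borelMr (b g : {'GL_2[F]}) : b \in borel F ->
  ((g * b)%g \in borel F) = (g \in borel F).
Proof.
have gl_groupMr (H : {group {'GL_2[F]}}) x y : y \in H -> ((x * y)%g \in H) = (x \in H).
  exact: groupMr.
exact: (gl_groupMr (borel_group F) g b).
Qed.

Lemma borelJ (b g : {'GL_2[F]}) : b \in borel F ->
  ((b * g * b^-1)%g \in borel F) = (g \in borel F).
Proof. by move=> Bb; rewrite borelMr ?borelV // borelMl. Qed.

Lemma uni_borel s : uni s \in borel F.
Proof. by rewrite gl2_borel ?uni_det. Qed.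

End Coordinates.

Arguments gl2 {F} (a b c d)%_ring_scope.

(** * Induced representations and the principal series *)

Section LinearCharacters.

Variables (C : fieldType) (gT : finGroupType) (H : {group gT}) (chi : lchar C H).

Lemma lcharV x : x \in H -> chi x * chi x^-1%g = 1.
Proof. by move=> Hx; rewrite -lcharM ?groupV // mulgV lchar1. Qed.

Lemma lchar_neq0 x : x \in H -> chi x != 0.
Proof.
move=> Hx; apply: contra_eq_neq (lcharV Hx) => ->.
by rewrite mul0r eq_sym oner_eq0.
Qed.

Lemma lcharJ b x : b \in H -> x \in H -> chi (b * x * b^-1)%g = chi x.
Proof.
by move=> Hb Hx; rewrite !lcharM ?groupM ?groupV // mulrAC lcharV // mul1r.
Qed.

End LinearCharacters.

Section Induced.

Variables (C : fieldType) (gT : finGroupType) (G H : {group gT}).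
Variables (sHG : H \subset G) (chi : lchar C H).
Implicit Type i j : 'I_#|rcosets H G|.
Notation r := (@ind_rep gT G H).

Lemma ind_repVK i j : (r i * (r j)^-1 \in H)%g = (i == j).
Proof.
rewrite -mem_rcoset; apply/idP/eqP=> [/rcoset_eqP eqij|->].
  by apply: enum_val_inj; rewrite !ind_rep_coset.
exact: rcoset_refl.
Qed.

Lemma mxtrace_ind g :
  \tr (ind_repr sHG chi g) = \sum_i lchar_ext chi (r i * g * (r i)^-1)%g.
Proof. by apply: eq_bigr => i _; rewrite !mxE. Qed.

(** When g stabilizes the coset of index j, the matrix of g has a single nonzero
    entry in column j, on the diagonal. *)
Lemma ind_mx_stab i j g : (r j * g * (r j)^-1 \in H)%g ->
  ind_mx G chi g i j = chi (r j * g * (r j)^-1)%g *+ (i == j).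
Proof.
move=> Hg; rewrite mxE /lchar_ext.
have -> : (r i * g * (r j)^-1 = r i * (r j)^-1 * (r j * g * (r j)^-1))%g.
  by rewrite !mulgA mulgKV.
rewrite groupMr // ind_repVK; case: eqP => [->|//].
by rewrite mulgV mul1g.
Qed.

Lemma ind_repr_central z : z \in 'Z(H)%g -> z \in 'C(G)%g ->
  ind_repr sHG chi z = (chi z)%:M.
Proof.
case/setIP=> Hz _ /centP cGz; apply/matrixP=> i j.
have zK : (r j * z * (r j)^-1)%g = z.
  by rewrite -cGz ?ind_repG // mulgK.
by rewrite /= ind_mx_stab zK // !mxE.
Qed.

Lemma ind_rep_base : {i0 | r i0 \in H}.
Proof.
have HG : (H :* 1)%g \in rcosets H G by apply/rcosetsP; exists 1%g.
exists (enum_rank_in HG (H :* 1)%g); set i := enum_rank_in _ _.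
have <- : (H :* r i)%g = H by rewrite -ind_rep_coset enum_rankK_in // mulg1.
exact: rcoset_refl.
Qed.

Lemma ind_rep_in i i0 : r i0 \in H -> (r i \in H) = (i == i0).
Proof. by move=> Hi0; rewrite -ind_repVK groupMr ?groupV. Qed.

Lemma ind_mx_coord (v : 'rV_#|rcosets H G|) g j :
  (r j * g * (r j)^-1)%g \in H ->
  (v *m ind_mx G chi g) 0 j = v 0 j * chi (r j * g * (r j)^-1)%g.
Proof.
move=> Hg; rewrite !mxE (bigD1 j) //= big1 ?addr0 => [|i ne_i].
  by rewrite ind_mx_stab // eqxx.
by rewrite ind_mx_stab // (negPf ne_i) mulr0.
Qed.

(** The basis vector at the coset H is an eigenvector of H; by
    [ind_mx_transport] below, its translates are all the basis vectors. *)
Lemma ind_mx_base i0 b : r i0 \in H -> b \in H ->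
  delta_mx 0 i0 *m ind_mx G chi b = chi b *: delta_mx 0 i0 :> 'rV_#|rcosets H G|.
Proof.
move=> Hi0 Hb; rewrite -rowE; apply/rowP=> j; rewrite !mxE eqxx /= /lchar_ext.
have [->|ne_j] := eqVneq j i0.
  by rewrite !groupM ?groupV // lcharJ // mulr1.
by rewrite mulr0 ifN // groupMl ?groupM // groupV (ind_rep_in j Hi0).
Qed.

Lemma ind_mx_transport i j :
  delta_mx 0 i *m ind_mx G chi ((r i)^-1 * r j)%g = delta_mx 0 j :> 'rV_#|rcosets H G|.
Proof.
rewrite -rowE; apply/rowP=> l; rewrite !mxE eqxx mulKVg /lchar_ext.
by rewrite ind_repVK eq_sym; case: eqP => [->|//]; rewrite mulgV lchar1.
Qed.

End Induced.

Section MackeyCriterion.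

Variables (C : numClosedFieldType) (gT : finGroupType) (G H : {group gT}).
Variables (sHG : H \subset G) (chi : lchar C H).
Notation r := (@ind_rep gT G H).
Notation P := (ind_repr sHG chi).

(** Mackey's irreducibility criterion for an induced linear character: outside H,
    the character and its conjugate differ on the intersection of H with its
    conjugate. *)
Hypothesis chi_moved : forall g, g \in G -> g \notin H -> exists b,
  [/\ b \in H, (g * b * g^-1)%g \in H & chi (g * b * g^-1)%g != chi b].

(** At the coset of g, an element b as in [chi_moved] acts on the coordinate by
    chi(g b g^-1), whereas b acts on the whole vector by chi(b) <> chi(g b g^-1). *)
Lemma ind_eigenspace i0 (v : 'rV_#|rcosets H G|) : r i0 \in H ->
  (forall b, b \in H -> v *m ind_mx G chi b = chi b *: v) ->
  v = v 0 i0 *: delta_mx 0 i0.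
Proof.
move=> Hi0 eig_v; apply/rowP=> j; rewrite !mxE eqxx.
have [->|ne_j] := eqVneq j i0; first by rewrite mulr1.
rewrite mulr0; have [||b [Hb Hjb neq_chi]] := @chi_moved (r j).
- exact: ind_repG.
- by rewrite (ind_rep_in j Hi0).
apply: contraNeq neq_chi => nz_vj; apply/eqP/(mulIf nz_vj).
by rewrite mulrC -ind_mx_coord // eig_v // mxE.
Qed.

(** The vector e0 generates the representation and spans the chi-eigenspace of
    H.  If the representation is a direct sum U + W of submodules, both
    components of e0 are eigenvectors, hence multiples of e0, so that e0 lies
    in U or in W. *)
Theorem ind_repr_irr : mx_irreducible P.
Proof.
have [i0 Hi0] := ind_rep_base G H.
pose e0 : 'rV[C]_#|rcosets H G| := delta_mx 0 i0.
have gen_e0 (U : 'M_#|rcosets H G|) : mxmodule P U -> (e0 <= U)%MS -> row_full U.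
  move=> /mxmoduleP modU e0U; rewrite -sub1mx; apply/row_subP=> j.
  rewrite row1 -(ind_mx_transport chi i0).
  apply: submx_trans (submxMr _ e0U) (modU _ _).
  by rewrite groupM ?groupV ?ind_repG.
apply/mx_irrP; split=> [|U modU nzU].
  exact: leq_ltn_trans (leq0n i0) (ltn_ord i0).
have [W modW defW dxW] := mx_Maschke_pchar P (pchar'_group _ _) modU (submx1 U).
have eig_proj (U1 U2 : 'M_#|rcosets H G|) :
    mxmodule P U1 -> mxmodule P U2 -> (U1 + U2 :=: 1%:M)%MS ->
    (U1 :&: U2 = 0)%MS -> e0 *m proj_mx U1 U2 != 0 -> row_full U1.
  move=> mod1 mod2 sum12 cap12 nzp; apply: gen_e0 => //.
  set u := e0 *m _ in nzp; have u_U1 : (u <= U1)%MS by apply: proj_mx_sub.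
  have eig_u : u = u 0 i0 *: e0.
    apply: ind_eigenspace => // b Hb.
    have /hom_mxP hom_p : (1%:M <= dom_hom_mx P (proj_mx U1 U2))%MS.
      by rewrite -sum12 proj_mx_hom.
    have /= := hom_p b (subsetP sHG b Hb); rewrite !mul1mx => comm.
    by rewrite -mulmxA -comm mulmxA ind_mx_base // -scalemxAl.
  rewrite eig_u scaler_eq0 negb_or in nzp; case/andP: nzp => nzu _.
  by move: u_U1; rewrite eig_u; rewrite (eqmx_scale _ nzu).
have capUW := mxdirect_addsP dxW.
have [pU0|] := eqVneq (e0 *m proj_mx U W) 0; last exact: eig_proj.
have fullW : row_full W.
  apply: (eig_proj W U) => //; [by rewrite addsmxC | by rewrite capmxC |].
  apply/eqP=> pW0; have : e0 = 0.
    by rewrite -(@add_proj_mx _ _ _ U W e0) // ?pU0 ?pW0 ?addr0 // defW submx1.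
  by move/rowP/(_ i0); rewrite !mxE !eqxx => /eqP; rewrite oner_eq0.
case/eqP: nzU; apply/eqP; rewrite -submx0 -capUW sub_capmx submx_refl /=.
exact: submx_full.
Qed.

End MackeyCriterion.

Section PrincipalSeries.

Variables (C : numClosedFieldType) (F : finFieldType) (alpha beta : Fchar C F).
Notation B := (borel_group F).
Notation P := (principal_series alpha beta).
Notation chi := (borel_char alpha beta).
Notation GT := [set: {'GL_2[F]}]%G.

Lemma borel_char_gl2 a b d : a != 0 -> d != 0 ->
  chi (gl2 a b 0 d) = alpha (to_unit a) * beta (to_unit d).
Proof. by move=> nza nzd; rewrite /= /borel_char_fun val_gl2 ?upper_det // !mxE. Qed.

(** By the Bruhat decomposition the cosets B and B w u, for u in U, are all the
    cosets of B. *)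
Lemma card_rcosets_borel : #|rcosets B GT| = #|F|.+1.
Proof.
pose rr (o : option F) : {'GL_2[F]} := if o is Some s then (weyl F * uni s)%g else 1%g.
have -> : rcosets B GT = [set (B :* rr o)%g | o : option F].
  apply/setP=> A; apply/rcosetsP/imsetP=> [[g _ ->]|[o _ ->]]; last by exists (rr o).
  have [Bg|/bruhat[b Bb [s ->]]] := boolP (g \in borel F).
    by exists None; rewrite //= mulg1 rcoset_id.
  by exists (Some s); rewrite //= -mulgA rcosetM rcoset_id.
rewrite card_imset ?card_option // => o o' /rcoset_eqP.
case: o o' => [s|] [t|] //=.
- rewrite mem_rcoset invMg weylV -uniN mulgA -(mulgA (weyl F)) -uniD.
  rewrite /weyl /uni gl2M ?weyl_det ?uni_det //.
  rewrite gl2M ?weyl_det //; last first.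
    by rewrite (_ : _ - _ = -1) ?oppr_eq0 ?oner_neq0 //; ring.
  rewrite gl2_borel; last first.
    by rewrite (_ : _ - _ = 1) ?oner_neq0 //; ring.
  rewrite [X in X == 0](_ : _ = s - t); last by ring.
  by rewrite subr_eq0 => /eqP->.
- by rewrite mulg1 => Bs; case/negP: (weyl_uni_notin_borel s).
rewrite mem_rcoset mul1g groupV => Bs; by case/negP: (weyl_uni_notin_borel t).
Qed.

Lemma ps_degree : rdegree P = #|F|.+1.
Proof. exact: card_rcosets_borel. Qed.

Lemma ps_scalar x : P (GL2_scalar x) = (alpha x * beta x)%:M.
Proof.
rewrite [LHS]ind_repr_central.
- by rewrite scalarE borel_char_gl2 ?val_unit_neq0 // to_unitK.
- rewrite inE scalarE gl2_borel ?diag_det ?val_unit_neq0 // eqxx /=.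
  apply/centP=> g _; have [a [b [c [d [nz ->]]]]] := gl2P g.
  by rewrite /commute !gl2M ?diag_det ?val_unit_neq0 //; congr gl2; ring.
rewrite scalarE; apply/centP=> g _; have [a [b [c [d [nz ->]]]]] := gl2P g.
by rewrite /commute !gl2M ?diag_det ?val_unit_neq0 //; congr gl2; ring.
Qed.

Lemma jordan_borel x : GL2_jordan x \in borel F.
Proof. by rewrite jordanE gl2_borel ?upper_det ?val_unit_neq0. Qed.

(** A Jordan block has a single eigenline, so the only coset of B that it fixes
    is B itself; this is why its trace below has a single term. *)
Lemma jordan_conj_borel g x :
  (g * GL2_jordan x * g^-1 \in borel F)%g = (g \in borel F).
Proof.
apply/idP/idP=> [|Bg]; last by rewrite borelJ // jordan_borel.
apply: contraLR => /bruhat[b Bb [s ->]].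
have us_j : (uni s * GL2_jordan x = GL2_jordan x * uni s)%g.
  rewrite jordanE /uni !gl2M ?uni_det ?upper_det ?val_unit_neq0 //.
  by congr gl2; ring.
have -> : (b * weyl F * uni s * GL2_jordan x * (b * weyl F * uni s)^-1 =
  b * (weyl F * GL2_jordan x * (weyl F)^-1) * b^-1)%g.
  by rewrite -!mulgA (mulgA (uni s)) us_j !invMg !mulgA mulgK.
rewrite borelJ // jordanE; move: (val x) (val_unit_neq0 x) => a nza.
have nz : a * a - 0 * 1 != 0 by rewrite mul0r subr0 mulf_neq0.


have -> : (weyl F * gl2 a 1 0 a * (weyl F)^-1 = gl2 a 0 1 a)%g.
  apply: canLR (mulgK _) _.
  rewrite /weyl !gl2M ?weyl_det ?upper_det //.
  by congr gl2; ring.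
by rewrite gl2_borel ?oner_eq0.
Qed.

Lemma ps_jordan x : \tr (P (GL2_jordan x)) = alpha x * beta x.
Proof.
rewrite mxtrace_ind; have [i0 Bi0] := ind_rep_base GT B.
rewrite (bigD1 i0) //= big1 ?addr0 => [|i ne_i]; last first.
  by rewrite /lchar_ext jordan_conj_borel (ind_rep_in i Bi0) ifN.
rewrite /lchar_ext jordan_conj_borel Bi0 lcharJ ?jordan_borel //.
by rewrite jordanE borel_char_gl2 ?val_unit_neq0 // to_unitK.
Qed.

Lemma ps_elliptic g :
  (forall h, (h * g * h^-1)%g \notin borel F) -> \tr (P g) = 0.
Proof.
by move=> notB; rewrite mxtrace_ind big1 // => i _; rewrite /lchar_ext ifN.
Qed.

Section Irreducibility.

Hypothesis neq_ab : ~ eq_lchar alpha beta.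

Lemma neq_lchar_at : exists x, alpha x != beta x.
Proof.
have [/existsP//|/existsPn eq_ab] := boolP [exists x, alpha x != beta x].
by case: neq_ab => x _; apply/eqP/negPn.
Qed.

(** For g = b0 w u take b = u^-1 diag(x, 1) u with alpha(x) <> beta(x): the Weyl
    element conjugates diag(x, 1) to diag(1, x). *)
Lemma borel_char_swap g : g \notin borel F -> exists b,
  [/\ b \in borel F, (g * b * g^-1)%g \in borel F & chi (g * b * g^-1)%g != chi b].
Proof.
case/bruhat=> b0 Bb0 [s ->]; have [x nx] := neq_lchar_at.
have Bu : uni s \in borel F := uni_borel s.
pose t := gl2 (val x) 0 0 1; pose t' := gl2 1 0 0 (val x).
have nz1 : (1 : F) != 0 := oner_neq0 F.
have Bt : t \in borel F by rewrite gl2_borel ?diag_det ?val_unit_neq0.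
have Bt' : t' \in borel F by rewrite gl2_borel ?diag_det ?val_unit_neq0.
have wt : (weyl F * t = t' * weyl F)%g.
  rewrite /t /t' /weyl !gl2M ?weyl_det ?diag_det ?val_unit_neq0 //.
  by congr gl2; ring.
exists ((uni s)^-1 * t * uni s)%g; have -> : (b0 * weyl F * uni s *
  ((uni s)^-1 * t * uni s) * (b0 * weyl F * uni s)^-1 = b0 * t' * b0^-1)%g.
  rewrite !invMg -!mulgA mulKVg (mulgA (weyl F)) wt !mulgA.
  by rewrite mulgK mulgK.
split; [by rewrite borelMr ?borelMl ?borelV | by rewrite borelJ |].
have -> : chi ((uni s)^-1 * t * uni s)%g = chi t.
  by rewrite -[X in (_ * X)%g]invgK lcharJ // borelV.
rewrite lcharJ // !borel_char_gl2 ?val_unit_neq0 // !to_unitK.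
have -> : to_unit (1 : F) = 1%g.
  by apply: val_inj; rewrite val_to_unit.
by rewrite !lchar1 mul1r mulr1 eq_sym.
Qed.

Theorem ps_irrep : irrep P.
Proof. by apply: ind_repr_irr => g _; apply: borel_char_swap. Qed.

End Irreducibility.

End PrincipalSeries.

(** * Characters of cuspidal type and products with the principal series *)

Section CuspidalCharacters.

Variables (C : numClosedFieldType) (F : finFieldType).
Implicit Type omega : {unit F} -> C.

Lemma mxtrace_conj (gT : finGroupType) (G : {group gT}) n
    (V : mx_representation C G n) g h :
  g \in G -> h \in G -> \tr (V (h * g * h^-1)%g) = \tr (V g).
Proof.
move=> Gg Gh; rewrite !repr_mxM ?groupM ?groupV //.
by rewrite mxtrace_mulC mulmxA -repr_mxM ?groupV // mulVg repr_mx1 mul1mx.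
Qed.

Lemma mxtrace_intertwined (gT : finGroupType) (G : {group gT}) n
    (V : mx_representation C G n) g g' h :
  g \in G -> h \in G -> (h * g = g' * h)%g -> \tr (V g) = \tr (V g').
Proof.
by move=> Gg Gh e; rewrite -(mxtrace_conj V Gg Gh) e mulgK.
Qed.

Lemma mem_GL2 (g : {'GL_2[F]}) : g \in [set: {'GL_2[F]}]%G.
Proof. exact: in_setT. Qed.

(** The classification of elements by their eigenvalues in F, in the form in which
    traces use it: no eigenvalue means no conjugate in B. *)
Lemma gl2_conj_cases (g : {'GL_2[F]}) :
  [\/ forall h, (h * g * h^-1)%g \notin borel F,
      exists h x, (h * g * h^-1)%g = GL2_scalar x,
      exists h x, (h * g * h^-1)%g = GL2_jordan x
    | exists h a b d,
        [/\ a != 0, d != 0, a != d & (h * g * h^-1)%g = gl2 a b 0 d]].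
Proof.
have [/existsP[h Bh]|/existsPn noB] :=
  boolP [exists h, (h * g * h^-1)%g \in borel F]; last by constructor 1.
have [a [b [d [nza nzd eg]]]] := borelP Bh.
have [ead|nad] := eqVneq a d; last by constructor 4; exists h, a, b, d.
rewrite -{d}ead in eg nzd *.
have [b0|nzb] := eqVneq b 0.
  by constructor 2; exists h, (to_unit a); rewrite scalarE val_to_unit // eg b0.
constructor 3; exists (gl2 1 0 0 b * h)%g, (to_unit a).
rewrite jordanE val_to_unit // invMg -!mulgA (mulgA h) (mulgA (h * g)%g) eg.
rewrite mulgA; apply: canLR (mulgK _) _.
have nz1 := oner_neq0 F.
by rewrite !gl2M ?upper_det //; congr gl2; ring.
Qed.

(** The part of the character of a cuspidal representation of central character
    omega that is seen by products with the principal series.  It does not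
    mention the values on the anisotropic torus, so that it also applies to
    representations that are not given by a character of the torus. *)
Record cuspidal_on_borel omega n (V : mx_representation C 'GL_2[F] n) : Prop :=
  CuspidalOnBorel {
    cuspidal_scalar : forall x, \tr (V (GL2_scalar x)) = #|F|.-1%:R * omega x;
    cuspidal_jordan : forall x, \tr (V (GL2_jordan x)) = - omega x;
    cuspidal_split : forall a b d, a != 0 -> d != 0 -> a != d ->
      \tr (V (gl2 a b 0 d)) = 0 }.

Lemma mxtrace_prod_repr n m (V : mx_representation C 'GL_2[F] n)
    (W : mx_representation C 'GL_2[F] m) g :
  \tr (prod_repr V W g) = \tr (V g) * \tr (W g).
Proof. exact: mxtrace_prod. Qed.

Lemma ps_prod_mxtrace_scalar (alpha beta : Fchar C F) omega n
    (V : mx_representation C 'GL_2[F] n) x : cuspidal_on_borel omega V ->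
  \tr (prod_repr (principal_series alpha beta) V (GL2_scalar x)) =
    (#|F|.+1 * #|F|.-1)%:R * (alpha x * beta x * omega x).
Proof.
case=> trV _ _; rewrite mxtrace_prod_repr trV ps_scalar mxtrace_scalar ps_degree.
by rewrite -mulr_natl natrM; ring.
Qed.

(** At each conjugacy class either one of the two factors has trace 0 or the product
    of the traces depends only on the product of the central characters. *)
Theorem ps_prod_rsim (alpha beta gamma delta : Fchar C F) omega omega' n m
    (V : mx_representation C 'GL_2[F] n) (V' : mx_representation C 'GL_2[F] m) :
  cuspidal_on_borel omega V -> cuspidal_on_borel omega' V' ->
  (forall x, alpha x * beta x * omega x = gamma x * delta x * omega' x) ->
  iso (prod_repr (principal_series alpha beta) V)
      (prod_repr (principal_series gamma delta) V').
Proof.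
move=> cV cV' eq_central; apply: mx_rsim_of_mxtrace => g _.
have trJ h k W := @mxtrace_conj _ _ k W g h (mem_GL2 g) (mem_GL2 h).
have [noB | [h [x eg]] | [h [x eg]] | [h [a [b [d [nza nzd nad eg]]]]]] :=
  gl2_conj_cases g.
- by rewrite !mxtrace_prod_repr !ps_elliptic ?mul0r.
- rewrite -!(trJ h) eg (ps_prod_mxtrace_scalar _ _ _ cV).
  by rewrite (ps_prod_mxtrace_scalar _ _ _ cV') eq_central.
- rewrite -!(trJ h) eg !mxtrace_prod_repr !ps_jordan.
  by rewrite (cuspidal_jordan cV) (cuspidal_jordan cV') !mulrN eq_central.
rewrite -!(trJ h) eg !mxtrace_prod_repr.
by rewrite (cuspidal_split cV) // (cuspidal_split cV') // !mulr0.
Qed.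

Lemma cardF_gt0 : (0 < #|F|)%N.
Proof. exact: ltn_trans (card_finNzRing_gt1 F). Qed.

Lemma cardF_pred_gt0 : (0 < #|F|.-1)%N.
Proof. by rewrite -subn1 subn_gt0 card_finNzRing_gt1. Qed.

Lemma cardF_natrE : #|F|%:R = #|F|.-1%:R + 1 :> C.
Proof. by rewrite -mulrSr prednK // cardF_gt0. Qed.

Lemma ps_prod_central (alpha beta gamma delta : Fchar C F) omega omega' n m
    (V : mx_representation C 'GL_2[F] n) (V' : mx_representation C 'GL_2[F] m) :
  cuspidal_on_borel omega V -> cuspidal_on_borel omega' V' ->
  iso (prod_repr (principal_series alpha beta) V)
      (prod_repr (principal_series gamma delta) V') ->
  forall x, alpha x * beta x * omega x = gamma x * delta x * omega' x.
Proof.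
move=> cV cV' /mxtrace_rsim eq_tr x.
have := eq_tr (GL2_scalar x) (mem_GL2 _).
rewrite (ps_prod_mxtrace_scalar _ _ _ cV) (ps_prod_mxtrace_scalar _ _ _ cV').
by apply: mulfI; rewrite pnatr_eq0 muln_eq0 negb_or /= -lt0n cardF_pred_gt0.
Qed.

Lemma cuspidal_rep_on_borel (L : fieldExtType F) (e : 2.-tuple L)
    (Lam : torus_char C e) (V : GL2_rep C F) :
  is_cuspidal_rep Lam V -> cuspidal_on_borel (bar Lam) V.
Proof.
case=> _ _ tr_s tr_j tr_split _; split=> // a b d nza nzd nad.
have nz : a * d - b * 0 != 0 := upper_det b nza nzd.
apply: (tr_split _ a d nad); apply/eigenvalueP; rewrite val_gl2 //.
  (* Row eigenvectors: (1, b / (a - d)) for a, and (0, 1) for d. *)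
  exists (\row_j if j == ord0 then 1 else b / (a - d)); last first.
    by apply/eqP=> /rowP/(_ ord0); rewrite !mxE eqxx => /eqP; rewrite oner_eq0.
  have nzad : a - d != 0 by rewrite subr_eq0.
  apply/rowP=> j; rewrite !mxE big_ord2 !mxE /=.
  by case: (ord2P j) => -> /=; field.
exists (\row_j if j == ord0 then 0 else 1); last first.
  by apply/eqP=> /rowP/(_ ord_max); rewrite !mxE => /eqP; rewrite oner_eq0.
apply/rowP=> j; rewrite !mxE big_ord2 !mxE /=.
by case: (ord2P j) => -> /=; ring.
Qed.

Lemma scalar_central (x : {unit F}) (g : {'GL_2[F]}) :
  (GL2_scalar x * g = g * GL2_scalar x)%g.
Proof.
rewrite scalarE; have [a [b [c [d [nz ->]]]]] := gl2P g.
by rewrite !gl2M ?diag_det ?val_unit_neq0 //; congr gl2; ring.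
Qed.

Lemma irr_scalar n (V : mx_representation C 'GL_2[F] n) x :
  mx_irreducible V -> is_scalar_mx (V (GL2_scalar x)).
Proof.
move=> irrV; apply: (mx_abs_irr_cent_scalar (group_closure_closed_field irrV)).
apply/centgmxP=> g _.
by rewrite -!repr_mxM ?mem_GL2 // scalar_central.
Qed.

Lemma cuspidal_scalarE omega n (V : mx_representation C 'GL_2[F] n) x :
  n = #|F|.-1 -> cuspidal_on_borel omega V -> mx_irreducible V ->
  V (GL2_scalar x) = (omega x)%:M.
Proof.
move=> def_n cV irrV; have /is_scalar_mxP[c Vx] := irr_scalar x irrV.
have := cuspidal_scalar cV x; rewrite Vx mxtrace_scalar def_n -(mulr_natl c).
by move/mulfI=> -> //; rewrite pnatr_eq0 -lt0n cardF_pred_gt0.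
Qed.

End CuspidalCharacters.

(** * Constituents without unipotent invariants *)

Section CuspidalConstituent.

Variables (C : numClosedFieldType) (F : finFieldType).
Local Notation q := #|F|.

(** This is q times the projector onto the U-invariants. *)
Definition unipotent_sum n (V : mx_representation C 'GL_2[F] n) : 'M[C]_n :=
  \sum_(s : F) V (uni s).

Lemma q_neq0 : q%:R != 0 :> C.
Proof. by rewrite pnatr_eq0 -lt0n cardF_gt0. Qed.

Section OneRepresentation.

Variables (n : nat) (V : mx_representation C 'GL_2[F] n).
Notation S := (unipotent_sum V).

Lemma GL2_reprM g h : V (g * h)%g = V g *m V h.
Proof. by apply: repr_mxM; apply: mem_GL2. Qed.

Lemma unipotent_sum_uni t : S *m V (uni t) = S.
Proof.
rewrite mulmx_suml [RHS](reindex_inj (addIr t)) /=.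
by apply: eq_bigr => s _; rewrite -GL2_reprM -uniD.
Qed.

Lemma unipotent_sum_sq : S *m S = q%:R *: S.
Proof.
rewrite {2}/unipotent_sum mulmx_sumr (eq_bigr (fun=> S)).
  by rewrite sumr_const scaler_nat.
by move=> t _; apply: unipotent_sum_uni.
Qed.

Lemma unipotent_sum_borel b : b \in borel F -> V b *m S = S *m V b.
Proof.
case/borelP=> [a [z [d [nza nzd ->]]]].
rewrite mulmx_suml mulmx_sumr (reindex_inj (mulfI nzd)) /=.
rewrite [RHS](reindex_inj (mulfI nza)) /=.
apply: eq_bigr => s _; rewrite -!GL2_reprM; congr (V _).
rewrite /uni !gl2M ?upper_det ?oner_neq0 //; congr gl2; ring.
Qed.

(** The rank of [unipotent_sum V] is the dimension of the U-invariants. *)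
Lemma mxtrace_unipotent_sum : \tr S = q%:R * (\rank S)%:R.
Proof.
pose E := q%:R^-1 *: S.
have idE : E *m E = E.
  rewrite /E -scalemxAl -scalemxAr unipotent_sum_sq !scalerA.
  by congr (_ *: _); rewrite -mulrA mulVf ?q_neq0 ?mulr1.
have := mxtrace_idempotent idE.
rewrite mxtraceZ mxrank_scale_nz ?invr_eq0 ?q_neq0 // => <-.
by rewrite mulrA mulfV ?q_neq0 ?mul1r.
Qed.

(** The submodule generated by the U-invariants. *)
Definition unipotent_span : 'M[C]_n := (\sum_(g : {'GL_2[F]}) S *m V g)%MS.

Lemma unipotent_span_module : mxmodule V unipotent_span.
Proof.
apply/mxmoduleP=> h _; rewrite sumsmxMr; apply/sumsmx_subP=> g _.
by rewrite -mulmxA -GL2_reprM (sumsmx_sup (g * h)%g).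
Qed.

(** The space S of U-invariants is stable under B, so by the Bruhat decomposition
    the span is the sum of S and of its q translates S w u.  One translate is
    superfluous: for v in S, the sum of the v w u over u in U is again in S, so
    that S w lies in the sum of S and of the other S w u. *)
Lemma rank_unipotent_span : (\rank unipotent_span <= q * \rank S)%N.
Proof.
pose N := (S + \sum_(s : F | s != 0) S *m V (weyl F * uni s)%g)%MS.
have SN : (S <= N)%MS by apply: addsmxSl.
have sN s : s != 0 -> (S *m V (weyl F * uni s)%g <= N)%MS.
  by move=> nzs; apply: submx_trans (addsmxSr _ _); rewrite (sumsmx_sup s).
have wN s : (S *m V (weyl F * uni s)%g <= N)%MS.
  have [->|] := eqVneq s 0; last exact: sN.
  (* The sum over all t of S w uni(t) is S w S, whose rows are in S. *)
  have -> : S *m V (weyl F * uni 0)%g =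
      S *m V (weyl F) *m S - \sum_(t : F | t != 0) S *m V (weyl F * uni t)%g.
    have -> : S *m V (weyl F) *m S = \sum_t S *m V (weyl F * uni t)%g.
      by rewrite [LHS]mulmx_sumr; apply: eq_bigr => t _; rewrite GL2_reprM mulmxA.
    by rewrite [X in _ = X - _](bigD1 0) //= addrK.
  rewrite addmx_sub ?(submx_trans (submxMl _ _)) // eqmx_opp.
  by apply: summx_sub => t; apply: sN.
have spanN : (unipotent_span <= N)%MS.
  apply/sumsmx_subP=> g _; have [Bg|] := boolP (g \in borel F).
    by rewrite -unipotent_sum_borel // (submx_trans (submxMl _ _)).
  case/bruhat=> b Bb [s ->]; rewrite -mulgA GL2_reprM mulmxA.
  by rewrite -unipotent_sum_borel // -mulmxA (submx_trans (submxMl _ _)).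
apply: leq_trans (mxrankS spanN) _.
apply: leq_trans (mxrank_adds_leqif _ _) _.
have -> : (q * \rank S = \rank S + \sum_(s : F | s != 0%R) \rank S)%N.
  by rewrite sum_nat_const cardC1 -mulSn prednK // cardF_gt0.
rewrite leq_add2l; apply: leq_trans (mxrank_sum_leqif _) _.
by apply: leq_sum => s _; apply: mxrankM_maxl.
Qed.

(** If the U-invariants do not generate V, a simple submodule of a complement of
    their span has no U-invariant vector.  Elements acting by scalars on V keep
    doing so, which transfers the central character. *)
Theorem cuspidal_constituent : (q * \rank S < n)%N ->
  exists m (W : mx_representation C 'GL_2[F] m),
    [/\ mx_irreducible W, unipotent_sum W = 0
      & forall g c, V g = c%:M -> W g = c%:M].
Proof.
move=> small; have modM := unipotent_span_module.
have [M' modM' sumM dxM] :=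
  mx_Maschke_pchar V (pchar'_group _ _) modM (submx1 _).
have nzM' : M' != 0.
  apply: contraTneq small => M'0; rewrite -leqNgt.
  apply: leq_trans rank_unipotent_span.
  by rewrite -{1}(mxrank1 C n) mxrankS // -sumM M'0 addsmx0.
have [T simT sTM'] := dec_mxsimple_exists modM' nzM'.
have modT := mxsimple_module simT.
exists (\rank T), (submod_repr modT); split.
- exact/submod_mx_irr.
- apply/eqP; rewrite -val_submod_eq0 -submx0 -(mxdirect_addsP dxM) sub_capmx.
  have -> : val_submod (unipotent_sum (submod_repr modT)) = val_submod 1%:M *m S.
    rewrite linear_sum mulmx_sumr; apply: eq_bigr => s _.
    by rewrite -val_submodJ ?mem_GL2 // mul1mx.
  apply/andP; split.
    apply: submx_trans (submxMl _ _) _.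
    by apply: (sumsmx_sup 1%g) => //; rewrite repr_mx1 mulmx1.
  apply: submx_trans sTM'; rewrite mulmx_sumr; apply: summx_sub => s _.
  by rewrite mxmodule_trans ?mem_GL2 ?val_submod1.
move=> g c Vg; apply: (can_inj (@val_submodK _ _ _ _)).
rewrite -[submod_repr modT g]mul1mx val_submodJ ?mem_GL2 // Vg.
by rewrite mul_mx_scalar -(scalemx1 _ c) linearZ.
Qed.

End OneRepresentation.

End CuspidalConstituent.

(** * Uniqueness of Whittaker models *)

Section SandwichTrace.

Lemma mulmx_delta (K : fieldType) n (P Q : 'M[K]_n) i j a b :
  (P *m delta_mx i j *m Q) a b = P a i * Q j b.
Proof.
rewrite -(mul_delta_mx (0 : 'I_1)) mulmxA -colE -mulmxA -rowE.
by rewrite !mxE big_ord1 !mxE.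
Qed.

(** For c = 1 this says that an idempotent P such that the algebra of the matrices
    P X P is commutative has rank at most 1.  Matrix units X and Y turn
    the hypothesis into an identity between entries of P, which is contracted
    twice. *)
Lemma sandwich_mxtrace (K : fieldType) n (P : 'M[K]_n) c :
  P != 0 -> P *m P = c *: P ->
  (forall X Y, P *m X *m P *m Y *m P = P *m Y *m P *m X *m P) ->
  (\tr P) ^+ 2 = c ^+ 2.
Proof.
move=> nzP PP comm.
have commE a i j k l b : P a i * (P j k * P l b) = P a k * (P l i * P j b).
  have assoc X Y : P *m X *m P *m Y *m P = P *m X *m (P *m Y *m P).
    by rewrite !mulmxA.
  have /matrixP/(_ a b) := comm (delta_mx i j) (delta_mx k l).
  by rewrite !assoc !mulmx_delta.
have sqE l b : \sum_k P l k * P k b = c * P l b.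
  by have /matrixP/(_ l b) := PP; rewrite !mxE.
have tr1 j k l b : \tr P * (P j k * P l b) = c * (P l k * P j b).
  rewrite /mxtrace mulr_suml (eq_bigr (fun i => P l i * P i k * P j b)).
    by rewrite -mulr_suml sqE mulrA.
  by move=> i _; rewrite commE mulrCA mulrA.
have tr2 l b : \tr P ^+ 2 * P l b = c ^+ 2 * P l b.
  transitivity (\sum_k \tr P * (P k k * P l b)).
    by rewrite -mulr_sumr -mulr_suml mulrA.
  rewrite (eq_bigr (fun k => c * (P l k * P k b))) => [|k _]; last exact: tr1.
  by rewrite -mulr_sumr sqE mulrA.
apply: contraNeq nzP => neq; apply/eqP/matrixP=> l b; rewrite mxE.
have /eqP := tr2 l b; rewrite -subr_eq0 -mulrBl mulf_eq0 subr_eq0 (negPf neq).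
by move/eqP.
Qed.

Lemma sandwich_span (K : fieldType) n (I : finType) (D : {pred I})
    (a : I -> 'M[K]_n -> K) (M : I -> 'M[K]_n) (P : 'M[K]_n) :
  (forall X, X = \sum_(i in D) a i X *: M i) ->
  (forall i j, P *m M i *m P *m M j *m P = P *m M j *m P *m M i *m P) ->
  forall X Y, P *m X *m P *m Y *m P = P *m Y *m P *m X *m P.
Proof.
move=> spanM commM.
have commX X j : P *m X *m P *m M j *m P = P *m M j *m P *m X *m P.
  rewrite (spanM X) !(mulmx_sumr, mulmx_suml); apply: eq_bigr => i _.
  by rewrite -!(scalemxAr, scalemxAl) commM.
move=> X Y; rewrite (spanM Y) !(mulmx_sumr, mulmx_suml); apply: eq_bigr => i _.
by rewrite -!(scalemxAr, scalemxAl) commX.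
Qed.

End SandwichTrace.

Section WhittakerModel.

Variables (C : numClosedFieldType) (F : finFieldType).
Local Notation q := #|F|.
Variables (n : nat) (W : mx_representation C 'GL_2[F] n).
Hypothesis irrW : mx_irreducible W.
Hypothesis noU : unipotent_sum W = 0.

Definition unipotents : {set {'GL_2[F]}} := [set uni s | s : F].

Lemma unipotents_group_set : group_set unipotents.
Proof.
apply/group_setP; split=> [|g h]; first by apply/imsetP; exists 0; rewrite ?uni0.
by move=> /imsetP[s _ ->] /imsetP[t _ ->]; rewrite -uniD imset_f.
Qed.

Canonical unipotents_group := Group unipotents_group_set.

Lemma unipotents_abelian : abelian unipotents_group.
Proof.
apply/centsP=> g /imsetP[s _ ->] h /imsetP[t _ ->].
by rewrite /commute -!uniD addrC.
Qed.

(** U is abelian, so W contains a common eigenvector v of U.  Its character psi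
    is nontrivial, since otherwise v would be U-invariant. *)
Lemma whittaker_character : exists2 psi : F -> C,
  (exists2 v : 'rV_n, v != 0 & forall s, v *m W (uni s) = psi s *: v) &
  [/\ forall s t, psi (s + t) = psi s * psi t, psi 0 = 1
    & exists t, psi t != 1].
Proof.
have sUG : unipotents_group \subset [set: {'GL_2[F]}] := subsetT _.
have [_ nz1 _] := irrW.
have [M simM _] := dec_mxsimple_exists (mxmodule1 (subg_repr W sUG)) nz1.
have rM : \rank M = 1%N.
  apply: mxsimple_abelian_linear simM; last exact: unipotents_abelian.
  exact: group_closure_closed_field.
pose v := nz_row M; have nzv : v != 0 := nz_row_mxsimple simM.
have vM : (v <= M)%MS := nz_row_sub M.
have Mv : (M <= v)%MS by rewrite -(geq_leqif (mxrank_leqif_sup vM)) rM rank_rV nzv.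
have eig s : exists a, v *m W (uni s) == a *: v.
  have Uu : uni s \in unipotents_group by rewrite imset_f.
  have /mxmoduleP/(_ _ Uu) modM := mxsimple_module simM.
  have /sub_rVP[a ->] : (v *m W (uni s) <= v)%MS.
    by apply: submx_trans (submx_trans (submxMr _ vM) modM) Mv.
  by exists a.
pose psi s := xchoose (eig s).
have eig_v s : v *m W (uni s) = psi s *: v by apply/eqP/(xchooseP (eig s)).
have psi_inj a b : a *: v = b *: v -> a = b.
  by move/eqP; rewrite -subr_eq0 -scalerBl scaler_eq0 (negPf nzv) orbF subr_eq0 => /eqP.
exists psi; first by exists v.
split=> [s t||].
- apply: psi_inj; rewrite -eig_v uniD GL2_reprM mulmxA eig_v -scalemxAl eig_v.
  by rewrite scalerA mulrC.
- by apply: psi_inj; rewrite -eig_v uni0 repr_mx1 mulmx1 scale1r.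
apply/existsP; apply: contraNT nzv => /existsPn psi1.
have := congr1 (mulmx v) noU; rewrite mulmx0 mulmx_sumr (eq_bigr (fun=> v)).
  move/eqP; rewrite sumr_const -scaler_nat scaler_eq0 (negPf (q_neq0 C F)).
  by [].
by move=> s _; rewrite eig_v; have /negPn/eqP-> := psi1 s; rewrite scale1r.
Qed.

Section Projector.

Variable psi : F -> C.
Hypotheses (psiD : forall s t, psi (s + t) = psi s * psi t) (psi0 : psi 0 = 1).
Hypothesis psi_nontrivial : exists t, psi t != 1.

(** This is q times the projector onto the psi-eigenspace of U. *)
Definition whittaker_mx : 'M[C]_n := \sum_s psi (- s) *: W (uni s).
Local Notation P := whittaker_mx.

Lemma psiN s : psi (- s) * psi s = 1.
Proof. by rewrite -psiD addNr psi0. Qed.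

Lemma psi_sum0 : \sum_s psi (- s) = 0.
Proof.
have [t nt] := psi_nontrivial; apply/eqP.
have /eqP : \sum_s psi (- s) = psi t * \sum_s psi (- s).
  rewrite {1}(reindex_inj (addrI (- t))) mulr_sumr.
  by apply: eq_bigr => s _; rewrite opprD opprK psiD.
rewrite -subr_eq0 -{1}[\sum_s _]mul1r -mulrBl mulf_eq0 subr_eq0 eq_sym.
by rewrite (negPf nt).
Qed.

Lemma whittaker_mx_uni t : P *m W (uni t) = psi t *: P.
Proof.
rewrite mulmx_suml scaler_sumr [RHS](reindex_inj (addIr t)) /=.
apply: eq_bigr => s _; rewrite -scalemxAl -GL2_reprM -uniD scalerA opprD psiD.
by rewrite mulrCA [psi t * _]mulrC psiN mulr1.
Qed.

Lemma uni_whittaker_mx t : W (uni t) *m P = psi t *: P.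
Proof.
rewrite -whittaker_mx_uni mulmx_suml mulmx_sumr; apply: eq_bigr => s _.
by rewrite -scalemxAl -scalemxAr -!GL2_reprM -!uniD addrC.
Qed.

Lemma whittaker_mx_sq : P *m P = q%:R *: P.
Proof.
rewrite {2}/whittaker_mx mulmx_sumr (eq_bigr (fun=> P)).
  by rewrite sumr_const scaler_nat.
by move=> t _; rewrite -scalemxAr whittaker_mx_uni scalerA psiN scale1r.
Qed.

(** Up to a scalar, the operator of the Hecke algebra of (G, U, psi) attached to
    the double coset of g; on a one-dimensional psi-eigenspace it is the Bessel
    function of W. *)
Definition bessel g : 'M[C]_n := P *m W g *m P.

Lemma bessel_unil s g : bessel (uni s * g)%g = psi s *: bessel g.
Proof. by rewrite /bessel GL2_reprM mulmxA whittaker_mx_uni -!scalemxAl. Qed.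

Lemma bessel_unir g s : bessel (g * uni s)%g = psi s *: bessel g.
Proof.
by rewrite /bessel GL2_reprM -!mulmxA uni_whittaker_mx -!scalemxAr.
Qed.

(** The anti-automorphism g |-> w g^T w.  It fixes U pointwise. *)
Definition swap_diag (g : {'GL_2[F]}) : {'GL_2[F]} :=
  gl2 (GLval g ord_max ord_max) (GLval g ord0 ord_max)
      (GLval g ord_max ord0) (GLval g ord0 ord0).

Lemma swap_diag_gl2 a b c d : a * d - b * c != 0 ->
  swap_diag (gl2 a b c d) = gl2 d b c a.
Proof. by move=> nz; rewrite /swap_diag val_gl2 // !mxE. Qed.

Lemma swap_diag_det (a b c d : F) : a * d - b * c != 0 -> d * a - b * c != 0.
Proof. by rewrite [d * a]mulrC. Qed.

Lemma swap_diagM g h : swap_diag (g * h)%g = (swap_diag h * swap_diag g)%g.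
Proof.
have [a [b [c [d [nz ->]]]]] := gl2P g.
have [a' [b' [c' [d' [nz' ->]]]]] := gl2P h.
rewrite gl2M // !swap_diag_gl2 //; last first.
  rewrite (_ : _ - _ = (a * d - b * c) * (a' * d' - b' * c')); last by ring.
  by rewrite mulf_neq0.
have nzs := swap_diag_det nz; have nzs' := swap_diag_det nz'.
by rewrite gl2M //; congr gl2; ring.
Qed.

Lemma swap_diag_uni s : swap_diag (uni s) = uni s.
Proof. by rewrite swap_diag_gl2 ?uni_det. Qed.

(** Conjugation by diag(a, d) multiplies the parameter of U by a / d, and psi is
    not invariant under it when a <> d. *)
Lemma bessel_upper0 a b d : a != 0 -> d != 0 -> a != d -> bessel (gl2 a b 0 d) = 0.
Proof.
move=> nza nzd nad; have [t nt] := psi_nontrivial.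
have nzad : a - d != 0 by rewrite subr_eq0.
(* Chosen so that a s = d (s + t). *)
pose s := t * d / (a - d).
have eq_st : (gl2 a b 0 d * uni s = uni (s + t) * gl2 a b 0 d)%g.
  by rewrite /uni !gl2M ?uni_det ?upper_det //; congr gl2; rewrite /s; field.
have := congr1 bessel eq_st; rewrite bessel_unir bessel_unil => /eqP.
rewrite -subr_eq0 -scalerBl scaler_eq0 psiD -{1}[psi s]mulr1 -mulrBr mulf_eq0.
rewrite subr_eq0 [1 == _]eq_sym (negPf nt) orbF => /orP[/eqP ps0|/eqP //].
by have /eqP := psiN s; rewrite ps0 mulr0 eq_sym oner_eq0.
Qed.

(** On the double cosets of U which support a nonzero operator: scalar matrices and
    antidiagonal matrices are fixed by the swap, and g and its image have the
    same decomposition with the two unipotent factors exchanged. *)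
Lemma bessel_swap g : bessel (swap_diag g) = bessel g.
Proof.
have [a [b [c [d [nz ->]]]]] := gl2P g; rewrite swap_diag_gl2 //.
have [c0|nzc] := eqVneq c 0.
  rewrite c0 mulr0 subr0 mulf_eq0 negb_or in nz *; case/andP: nz => nza nzd.
  have [->|nad] := eqVneq a d; first by [].
  by rewrite !bessel_upper0 // eq_sym.
pose b' := b - a * d / c.
have nzb' : 0 * 0 - b' * c != 0.
  by rewrite (_ : _ - _ = a * d - b * c) // /b'; field.
have decomp x z : x * z = a * d ->
    gl2 x b c z = (uni (x / c)%R * gl2 0 b' c 0 * uni (z / c)%R)%g.
  move=> xz; rewrite /uni gl2M ?uni_det // gl2M ?uni_det //.
    by congr gl2; rewrite /b' -?xz; field.
  by rewrite (_ : _ - _ = 0 * 0 - b' * c) //; ring.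
rewrite (decomp a d) // (decomp d a (mulrC d a)) !bessel_unir !bessel_unil.
by rewrite !scalerA [psi (a / c) * _]mulrC.
Qed.

Lemma bessel_mul g h : bessel g *m bessel h =
  q%:R *: \sum_s psi (- s) *: bessel (g * uni s * h)%g.
Proof.
have -> : bessel g *m bessel h = q%:R *: (P *m W g *m P *m W h *m P).
  rewrite /bessel !mulmxA -(mulmxA _ P P) whittaker_mx_sq.
  by rewrite -scalemxAr -!scalemxAl.
congr (_ *: _).
have -> : P *m W g *m P = \sum_s psi (- s) *: (P *m W g *m W (uni s)).
  by rewrite [LHS]mulmx_sumr; apply: eq_bigr => s _; rewrite -scalemxAr.
rewrite -mulmxA mulmx_suml; apply: eq_bigr => s _.
by rewrite -scalemxAl /bessel !GL2_reprM !mulmxA.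
Qed.

(** Gelfand's trick: the swap is an anti-automorphism that does not change the
    operators, so it reverses products without changing them. *)
Lemma bessel_comm g h : bessel g *m bessel h = bessel h *m bessel g.
Proof.
have swapE x y : bessel x *m bessel y = bessel (swap_diag y) *m bessel (swap_diag x).
  rewrite !bessel_mul; congr (_ *: _); apply: eq_bigr => s _.
  by rewrite -[in LHS]bessel_swap !swap_diagM swap_diag_uni mulgA.
by rewrite swapE !bessel_swap.
Qed.

Lemma whittaker_mx_sandwich X Y : P *m X *m P *m Y *m P = P *m Y *m P *m X *m P.
Proof.
have [_ [a_ span_W]] := mx_abs_irrP (group_closure_closed_field irrW).
have commG g h : P *m W g *m P *m W h *m P = P *m W h *m P *m W g *m P.
  apply: (scalerI (q_neq0 C F)).
  have := bessel_comm g h; rewrite /bessel !mulmxA -!(mulmxA _ P P).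
  by rewrite whittaker_mx_sq -!scalemxAr -!scalemxAl.
exact: (sandwich_span span_W).
Qed.

End Projector.

End WhittakerModel.

(** * The character of an irreducible representation without unipotent invariants *)

Section CuspidalOfNoFixedVector.

Variables (C : numClosedFieldType) (F : finFieldType).
Local Notation q := #|F|.
Variables (n : nat) (W : mx_representation C 'GL_2[F] n).

(** The diagonal matrices permute the nontrivial elements of U transitively. *)
Lemma mxtrace_uni s : s != 0 -> \tr (W (uni s)) = \tr (W (uni 1)).
Proof.
move=> nzs; apply/esym/(@mxtrace_intertwined _ _ _ _ W _ _ (gl2 s 0 0 1)).
- exact: mem_GL2.
- exact: mem_GL2.
by rewrite /uni !gl2M ?uni_det ?diag_det ?oner_neq0 //; congr gl2; ring.
Qed.

Lemma sum_mxtrace_uni (a : F -> C) : a 0 = 1 ->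
  \sum_s a s * \tr (W (uni s)) =
  n%:R + (\sum_s a s - 1) * \tr (W (uni 1)).
Proof.
move=> a0; rewrite (bigD1 0) //= [in RHS](bigD1 0) //= a0 uni0 repr_mx1.
rewrite mxtrace1 mul1r addrAC subrr add0r mulr_suml; congr (_ + _).
by apply: eq_bigr => s nzs; rewrite mxtrace_uni.
Qed.

Hypothesis irrW : mx_irreducible W.
Hypothesis noU : unipotent_sum W = 0.

Lemma mxtrace_uni1 : n%:R + q.-1%:R * \tr (W (uni 1)) = 0.
Proof.
have := sum_mxtrace_uni (a := fun=> 1) erefl.
rewrite (eq_bigr (fun s => \tr (W (uni s)))) => [|s _]; last by rewrite mul1r.
rewrite -raddf_sum -/(unipotent_sum W) noU raddf0 sumr_const => ->.
by rewrite (cardF_natrE C F) addrK.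
Qed.

(** With n = dim W, and t the trace at the nontrivial elements of U, the absence of
    invariants gives n + (q-1) t = 0, and tr P = n - t because the values of psi
    sum to 0; thus (q-1) tr P = q n.  Now (tr P)^2 = q^2. *)
Lemma cuspidal_degree : n = q.-1.
Proof.
have [psi [v nzv eig_v] [psiD psi0 nt_psi]] := whittaker_character irrW noU.
pose P := whittaker_mx W psi.
have nzP : P != 0.
  apply: contraNneq nzv => P0; have := congr1 (mulmx v) P0.
  rewrite mulmx0 mulmx_sumr (eq_bigr (fun=> v)) => [|s _]; last first.
    by rewrite -scalemxAr eig_v scalerA (psiN psiD psi0) scale1r.
  by move/eqP; rewrite sumr_const -scaler_nat scaler_eq0 (negPf (q_neq0 C F)).
have sq_trP : \tr P ^+ 2 = q%:R ^+ 2.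
  apply: sandwich_mxtrace nzP (whittaker_mx_sq W psiD psi0) _.
  by apply: whittaker_mx_sandwich.
have trP : \tr P = n%:R - \tr (W (uni 1)).
  rewrite raddf_sum (eq_bigr (fun s => psi (- s) * \tr (W (uni s)))).
    by rewrite sum_mxtrace_uni ?oppr0 // (psi_sum0 psiD nt_psi) sub0r mulN1r.
  by move=> s _ /=; rewrite mxtraceZ.
have trP1 : q.-1%:R * \tr P = q%:R * n%:R.
  have -> : q%:R * n%:R = q%:R * n%:R - (n%:R + q.-1%:R * \tr (W (uni 1))).
    by rewrite mxtrace_uni1 subr0.
  by rewrite trP (cardF_natrE C F); ring.
have : (q.-1%:R : C) ^+ 2 = n%:R ^+ 2.
  apply: (mulfI (expf_neq0 2 (q_neq0 C F))).
  by rewrite -[in RHS]exprMn -trP1 exprMn sq_trP mulrC.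
by move/(pexpIrn (n := 2)); rewrite ?nnegrE ?ler0n //= => /(_ isT isT isT)/eqP;
  rewrite eqr_nat => /eqP.
Qed.

(** For g upper triangular with distinct diagonal entries, all the g u with u in U
    are conjugate to g, so q tr W(g) is the trace of W(g) times the sum over U,
    which is 0. *)
Theorem cuspidal_on_borel_of_no_fixed (omega : {unit F} -> C) :
  (forall x, W (GL2_scalar x) = (omega x)%:M) -> cuspidal_on_borel omega W.
Proof.
move=> scalW; have nzq1 : q.-1%:R != 0 :> C by rewrite pnatr_eq0 -lt0n cardF_pred_gt0.
have tr1 : \tr (W (uni 1)) = -1.
  apply: (mulfI nzq1); have := mxtrace_uni1; rewrite {1}cuspidal_degree => /eqP.
  by rewrite addrC addr_eq0 mulrN1 => /eqP.
split=> [x|x|a b d nza nzd nad].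
- by rewrite scalW mxtrace_scalar cuspidal_degree mulr_natl.
- have -> : GL2_jordan x = (GL2_scalar x * uni (val x)^-1%R)%g.
    rewrite jordanE scalarE; have : val x != 0 := val_unit_neq0 x.
    move: (val x : F) => y nzy; rewrite /uni gl2M ?uni_det ?diag_det //.
    by congr gl2; field.
  rewrite GL2_reprM scalW mul_scalar_mx mxtraceZ mxtrace_uni ?invr_eq0 ?val_unit_neq0 //.
  by rewrite tr1 mulrN1.
apply: (mulfI (q_neq0 C F)); rewrite mulr0.
transitivity (\tr (W (gl2 a b 0 d) *m unipotent_sum W)); last first.
  by rewrite noU mulmx0 raddf0.
rewrite mulmx_sumr raddf_sum (eq_bigr (fun=> \tr (W (gl2 a b 0 d)))).
  by rewrite sumr_const mulr_natl.
move=> s _ /=; rewrite -GL2_reprM.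
have nzda : d - a != 0 by rewrite subr_eq0 eq_sym.
(* The parameter r of the conjugating matrix solves a (s + r) = r d. *)
apply/esym/(@mxtrace_intertwined _ _ _ _ W _ _ (uni (a * s / (d - a)))).
- exact: mem_GL2.
- exact: mem_GL2.
have nz1 := oner_neq0 F.
by rewrite /uni !upperM ?mulf_neq0 //; congr gl2; field.
Qed.

End CuspidalOfNoFixedVector.

(** * Characters of the multiplicative group and one-dimensional representations *)

Section CharactersOfFieldUnits.

Variables (C : numClosedFieldType) (F : finFieldType).

Lemma numClosed_prim_root n : (0 < n)%N -> exists z : C, n.-primitive_root z.
Proof.
move=> n_gt0; have [r] := closed_field_poly_normal ('X^n - 1 : {poly C}).
rewrite (monicP _) ?monicXnsubC // scale1r => factor.
have uniq_r : uniq r.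
  by rewrite -separable_prod_XsubC -factor separable_Xn_sub_1 // pnatr_eq0 -lt0n.
have roots_r : all n.-unity_root r.
  by apply/allP=> z r_z; rewrite /root_of_unity factor root_prod_XsubC.
have size_r : (n <= size r)%N.
  by rewrite -ltnS -(size_prod_XsubC r id) -factor size_XnsubC.
by have /hasP[z _ prim_z] := has_prim_root n_gt0 roots_r uniq_r size_r; exists z.
Qed.

Lemma unit_in_setT (x : {unit F}) : x \in [set: {unit F}]%G.
Proof. exact: in_setT. Qed.

Lemma FcharM (chi : Fchar C F) x y : chi (x * y)%g = chi x * chi y.
Proof. exact: lcharM. Qed.

Lemma Fchar_neq0 (chi : Fchar C F) x : chi x != 0.
Proof. exact: (@lchar_neq0 _ _ [set: {unit F}]%G chi x (unit_in_setT x)). Qed.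

Definition Fchar_one : Fchar C F.
Proof. by exists (fun=> 1) => // x y _ _; rewrite mulr1. Defined.

Definition Fchar_mul (chi psi : Fchar C F) : Fchar C F.
Proof.
exists (fun x => chi x * psi x); first by rewrite !lchar1 mulr1.
by move=> x y _ _; rewrite !FcharM mulrACA.
Defined.

Definition Fchar_inv (chi : Fchar C F) : Fchar C F.
Proof.
exists (fun x => (chi x)^-1); first by rewrite lchar1 invr1.
by move=> x y _ _; rewrite FcharM invfM.
Defined.

Lemma exists_faithful_Fchar : exists (kappa : Fchar C F) (eps : {unit F}),
  #|F|.-1.-primitive_root (kappa eps).
Proof.
have /cyclicP[eps def_eps] := field_unit_group_cyclic [set: {unit F}]%G.
have ord_eps : #[eps]%g = #|F|.-1 by rewrite -card_finField_unit def_eps.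
have [z prim_z] := numClosed_prim_root (cardF_pred_gt0 F).
have log_ex x : exists i, x == (eps ^+ i)%g.
  have : x \in <[eps]>%g by rewrite -def_eps inE.
  by case/cycleP=> i ->; exists i.
(* A discrete logarithm; it matters only modulo the order q - 1 of z. *)
pose log x := xchoose (log_ex x).
have logK x : (eps ^+ log x)%g = x by apply/esym/eqP/(xchooseP (log_ex x)).
have eq_log i j : (eps ^+ i == eps ^+ j)%g -> z ^+ i = z ^+ j.
  by rewrite eq_expg_mod_order ord_eps -(eq_prim_root_expr prim_z) => /eqP.
have log1 : z ^+ log 1%g = 1 by rewrite -(expr0 z); apply: eq_log; rewrite logK.
have logM : {in [set: {unit F}] &,
    {morph (fun x => z ^+ log x) : x y / (x * y)%g >-> x * y}}.
  by move=> x y _ _; rewrite -exprD; apply: eq_log; rewrite expgD !logK.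
exists (LChar log1 logM), eps => /=.
suff -> : z ^+ log eps = z by [].
by rewrite -[RHS]expr1; apply: eq_log; rewrite logK expg1.
Qed.

End CharactersOfFieldUnits.

Section LinearRepresentations.

Variables (C : numClosedFieldType) (F : finFieldType).
Variable chi : mx_representation C 'GL_2[F] 1.

Lemma linear_mxtraceM g h : \tr (chi (g * h)%g) = \tr (chi g) * \tr (chi h).
Proof.
rewrite GL2_reprM [chi g]mx11_scalar [chi h]mx11_scalar -scalar_mxM.
by rewrite !mxtrace_scalar.
Qed.

(** The scalar x is diag(x, 1) times diag(1, x), which are conjugate by the Weyl
    element; d is the value at diag(x, 1). *)
Lemma linear_mxtrace_scalar x :
  exists2 d : C, d ^+ #|F|.-1 = 1 & \tr (chi (GL2_scalar x)) = d ^+ 2.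
Proof.
pose D (y : {unit F}) := gl2 (val y) 0 0 1.
have nz1 := oner_neq0 F; have nzu := @val_unit_neq0 F.
have DM y z : D (y * z)%g = (D y * D z)%g.
  by rewrite /D upperM //; congr gl2; rewrite ?mulr0 ?mul0r ?addr0 ?mulr1.
have DX k : D (x ^+ k)%g = (D x ^+ k)%g.
  elim: k => [|k IHk]; first by rewrite !expg0; apply: gl2_1.
  by rewrite !expgS DM IHk.
have trX k : \tr (chi (D x ^+ k)%g) = \tr (chi (D x)) ^+ k.
  elim: k => [|k IHk]; first by rewrite expg0 repr_mx1 mxtrace1.
  by rewrite expgS linear_mxtraceM IHk exprS.
exists (\tr (chi (D x))).
  have x_q1 : (x ^+ #|F|.-1 = 1)%g.
    by rewrite -card_finField_unit expg_cardG ?unit_in_setT.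
  by rewrite -trX -DX x_q1 -(expg0 x) DX expg0 repr_mx1 mxtrace1.
have -> : GL2_scalar x = (D x * gl2 1 0 0 (val x))%g.
  by rewrite scalarE /D upperM //; congr gl2; rewrite ?mulr0 ?mul0r ?addr0 ?mulr1 ?mul1r.
rewrite linear_mxtraceM expr2; congr (_ * _).
apply/esym/(@mxtrace_intertwined _ _ _ _ chi _ _ (weyl F)).
- exact: mem_GL2.
- exact: mem_GL2.
by rewrite /D /weyl !gl2M ?weyl_det ?diag_det //; congr gl2; ring.
Qed.

End LinearRepresentations.

Section TensorScalar.

Variable K : fieldType.

Lemma tprodZl m1 n1 m2 n2 a (A : 'M[K]_(m1, n1)) (B : 'M[K]_(m2, n2)) :
  tprod (a *: A) B = a *: tprod A B.
Proof.
elim: m1 n1 A => [|m1 IHm] n1 A /=; first by rewrite scaler0.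
rewrite scale_col_mx; congr col_mx; last first.
  rewrite -IHm; apply: (congr1 (fun Z : 'M_(m1, n1) => tprod Z B)).
  by apply/matrixP=> i j; rewrite !mxE.
rewrite -!trowbE -linearZ; congr trowb.
by apply/matrixP=> i j; rewrite !mxE.
Qed.

Lemma tprodZr m1 n1 m2 n2 a (A : 'M[K]_(m1, n1)) (B : 'M[K]_(m2, n2)) :
  tprod A (a *: B) = a *: tprod A B.
Proof.
elim: m1 n1 A => [|m1 IHm] n1 A /=; first by rewrite scaler0.
by rewrite scale_col_mx IHm linearZ.
Qed.

Lemma tprod_scalar m n (a b : K) :
  tprod (a%:M : 'M_m) (b%:M : 'M_n) = (a * b)%:M.
Proof.
rewrite -[a%:M]scalemx1 -[b%:M]scalemx1 tprodZl tprodZr tprod1.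
by rewrite scalerA scalemx1.
Qed.

End TensorScalar.

(** * Non-unique decompositions *)

Section NonUniqueDecomposition.

Variables (C : numClosedFieldType) (F : finFieldType).
Local Notation q := #|F|.

Lemma GL2_scalar1 : GL2_scalar 1%g = 1%g :> {'GL_2[F]}.
Proof. by rewrite scalarE; apply: gl2_1. Qed.

Lemma jordan1 : GL2_jordan 1%g = uni 1 :> {'GL_2[F]}.
Proof. by rewrite jordanE. Qed.

(** In the product T of V with the principal series of (1, kappa), the trace at the
    nontrivial elements of U is -1, so the sum of the traces over U is
    (q+1)(q-1) - (q-1) = q(q-1) and [cuspidal_constituent] applies. *)
Lemma exists_cuspidal_with_center (kappa : Fchar C F) omega n
    (V : mx_representation C 'GL_2[F] n) :
  n = q.-1 -> cuspidal_on_borel omega V -> mx_irreducible V -> omega 1%g = 1 ->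
  exists m (W : mx_representation C 'GL_2[F] m),
    [/\ mx_irreducible W, m = q.-1
      & cuspidal_on_borel (fun x => kappa x * omega x) W].
Proof.
move=> def_n cV irrV omega1.
pose P := principal_series (Fchar_one C F) kappa.
pose T := prod_repr P V.
have trT : \tr (unipotent_sum T) = (q * q.-1)%:R.
  have -> : \tr (unipotent_sum T) = \sum_s 1 * \tr (T (uni s)).
    by rewrite raddf_sum; apply: eq_bigr => s _; rewrite mul1r.
  rewrite (sum_mxtrace_uni T (a := fun=> 1)) // -jordan1 mxtrace_prod_repr.
  rewrite ps_jordan (cuspidal_jordan cV) omega1 !lchar1 sumr_const.
  by rewrite ps_degree def_n !natrM -addn1 natrD (cardF_natrE C F); ring.
have small : (q * \rank (unipotent_sum T) < rdegree P * n)%N.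
  have /eqP := mxtrace_unipotent_sum T; rewrite trT -natrM eqr_nat => /eqP <-.
  by rewrite ps_degree def_n ltn_pmul2r ?cardF_pred_gt0.
have [m [W [irrW noU scalW]]] := cuspidal_constituent small.
exists m, W; have def_m := cuspidal_degree irrW noU; split=> //.
apply: cuspidal_on_borel_of_no_fixed => // x; apply: scalW.
have -> : kappa x * omega x = Fchar_one C F x * kappa x * omega x.
  by rewrite /= mul1r.
by rewrite -tprod_scalar -ps_scalar -(cuspidal_scalarE x def_n cV irrV).
Qed.

(** At eps, one of the factorizations theta = 1 theta and theta = kappa (theta / kappa)
    has two different factors, since both failing would give kappa(eps)^2 = 1. *)
Lemma factor_Fchar (theta kappa : Fchar C F) eps :
  (kappa eps) ^+ 2 != 1 -> exists gamma delta : Fchar C F,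
  ~ eq_lchar gamma delta /\ forall x, gamma x * delta x = theta x.
Proof.
move=> sq_kappa; have [theta1|ntheta] := eqVneq (theta eps) 1.
  exists kappa, (Fchar_mul theta (Fchar_inv kappa)); split=> [/(_ eps (in_setT _))|x] /=.
    rewrite theta1 mul1r => eq_kappa; case/eqP: sq_kappa.
    by rewrite expr2 {2}eq_kappa mulfV // Fchar_neq0.
  by rewrite mulrCA mulfV ?mulr1 // Fchar_neq0.
exists (Fchar_one C F), theta; split=> [/(_ eps (in_setT _))|x] /=;
  last by rewrite mul1r.
by move=> eq1; case/eqP: ntheta.
Qed.

(** With W of central character kappa omega, the isomorphism V = chi2 W would give
    chi2(eps) kappa(eps) = 1 with chi2(eps) = d^2 and d^(q-1) = 1.  Raised to the
    power (q-1)/2 this contradicts the order q-1 of kappa(eps).  The other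
    matching of the factors is excluded by dimensions. *)
Theorem not_unique_decomposition (alpha beta : Fchar C F) omega (V : GL2_rep C F) :
  odd q -> q <> 3%N -> rdegree V = q.-1 -> cuspidal_on_borel omega V ->
  irrep V -> omega 1%g = 1 ->
  ~ unique_decomposition (principal_series alpha beta) V.
Proof.
move=> odd_q q_neq3 def_n cV irrV omega1 uniqV.
have [kappa [eps prim_kappa]] := exists_faithful_Fchar C F.
have [m [W [irrW def_m cW]]] := exists_cuspidal_with_center kappa def_n cV irrV omega1.
have q_gt1 := card_finNzRing_gt1 F.
have q1_gt3 : (3 < q.-1)%N.
  by move: odd_q q_neq3 q_gt1; case: q => [|[|[|[|[|k]]]]].
have sq_kappa : kappa eps ^+ 2 != 1.
  rewrite -(prim_order_dvd prim_kappa); apply: contraTN q1_gt3 => /dvdn_leq le2.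
  by rewrite -leqNgt (leq_trans (le2 isT)).
pose theta := Fchar_mul (Fchar_mul alpha beta) (Fchar_inv kappa).
have [gamma [delta [neq_gd gd]]] := factor_Fchar theta sq_kappa.
have iso_VW : iso (prod_repr (principal_series alpha beta) V)
    (prod_repr (principal_series gamma delta) (Representation W)).
  apply: ps_prod_rsim cV cW _ => x; rewrite gd /= -!mulrA mulKf ?Fchar_neq0 //.
have [chi1 [chi2 [[_ isoV]|[isoP _]]]] :=
  uniqV _ (Representation W) (ps_irrep neq_gd) irrW iso_VW; last first.
  have := mxrank_rsim isoP; rewrite ps_degree /= def_m mul1n => /eqP.
  by rewrite eqn_leq leqNgt ltnS leq_pred.
have [d d_q1 tr_chi2] := linear_mxtrace_scalar chi2 eps.
have nzq1 : q.-1%:R != 0 :> C by rewrite pnatr_eq0 -lt0n cardF_pred_gt0.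
have nz_omega : omega eps != 0.
  have := repr_mx_unit V (mem_GL2 (GL2_scalar eps)).
  rewrite (cuspidal_scalarE _ def_n cV irrV) unitmxE det_scalar unitfE.
  by rewrite expf_eq0 def_n cardF_pred_gt0.
have d_kappa : d ^+ 2 * kappa eps = 1.
  have := mxtrace_rsim isoV (mem_GL2 (GL2_scalar eps)).
  rewrite mxtrace_prod_repr tr_chi2 (cuspidal_scalar cV) (cuspidal_scalar cW).
  rewrite mulrCA !mulrA => /(mulIf nz_omega) eq_d.
  apply: (mulfI nzq1); rewrite mulr1 {2}eq_d; ring.
have half_q : (q.-1./2).*2 = q.-1.
  by rewrite -[RHS]odd_double_half; move: odd_q q_gt1; case: q => //= k /negPf->.
have := congr1 (fun z => z ^+ q.-1./2) d_kappa.
rewrite exprMn expr1n -exprM mul2n half_q d_q1 mul1r => /eqP.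
rewrite -(prim_order_dvd prim_kappa) => /dvdn_leq.
move: half_q q1_gt3; case: (q.-1./2) => [|k] <- // _ /(_ isT).
by rewrite -addnn -[leqRHS]addn0 leq_add2l.
Qed.

End NonUniqueDecomposition.

(** * Products of a principal series and a cuspidal representation *)

Theorem theorem1p5 (R : realType) (p k : nat) (F : finFieldType)
    (p_prime : prime p) (p_odd : odd p) (k_gt0 : (0 < k)%N)
    (cardF : #|F| = (p ^ k)%N)
    (L : fieldExtType F) (dimL : \dim {:L} = 2%N) (e : 2.-tuple L)
    (e_basis : basis_of {:L} e) :
  (forall (Lam Phi : torus_char R[i] e) (alpha beta gamma delta : Fchar R[i] F)
      (chiLam chiPhi : GL2_rep R[i] F),
    ~ decomposable Lam -> ~ decomposable Phi ->
    is_cuspidal_rep Lam chiLam -> is_cuspidal_rep Phi chiPhi ->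
    ~ eq_lchar alpha beta -> ~ eq_lchar gamma delta ->
    iso (prod_repr (principal_series alpha beta) chiLam)
        (prod_repr (principal_series gamma delta) chiPhi)
    <->
    (forall x : {unit F},
       alpha x * beta x * bar Lam x = gamma x * delta x * bar Phi x)) /\
  (#|F| <> 3%N ->
   forall (Lam : torus_char R[i] e) (alpha beta : Fchar R[i] F)
      (chiLam : GL2_rep R[i] F),
    ~ decomposable Lam -> is_cuspidal_rep Lam chiLam ->
    ~ eq_lchar alpha beta ->
    ~ unique_decomposition (principal_series alpha beta) chiLam).
Proof.
split=> [Lam Phi alpha beta gamma delta V V' _ _ cuspV cuspV' _ _ | q_neq3].
  have cV := cuspidal_rep_on_borel cuspV; have cV' := cuspidal_rep_on_borel cuspV'.
  by split; [apply: ps_prod_central cV cV' | apply: ps_prod_rsim cV cV'].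
move=> Lam alpha beta V _ cuspV _.
apply: (not_unique_decomposition _ q_neq3 (cusp_dim cuspV)
  (cuspidal_rep_on_borel cuspV) (cusp_irr cuspV)).
  by rewrite cardF oddX p_odd orbT.
by rewrite /bar GL2_scalar1 lchar1.
Qed.
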